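(* Let $G$ be a finite group. (1) If $d_{2'}(G)>4/15$, then $G$ is solvable and has $2$-length at most $4$. (2) Assume $G$ is nonsolvable. Let $H=G/\mathbf{O}_2(G)$ and $Z=\mathbf{Z}(H)$. Then $d_{2'}(G)=4/15$ if and only if $H\cong A_5\times Z$.
   Context: For a finite group $G$, $k_{2'}(G)$ denotes the number of conjugacy classes of elements of odd order, $|G|_{2'}$ is the largest odd divisor of $|G|$, and $d_{2'}(G)=k_{2'}(G)/|G|_{2'}$. $\mathbf{O}_2(G)$ is the largest normal $2$-subgroup of $G$ and $\mathbf{Z}(H)$ the center of $H$. For a solvable group, the $2$-length is the minimum number of factors that are $2$-groups among normal series of $G$ whose factors are each either $2$-groups or groups of odd order. *)

(* Defs.v *)
From HB Require Import structures.
From mathcomp Require Import all_boot all_order all_algebra all_fingroup all_solvable.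
Set Implicit Arguments. Unset Strict Implicit. Unset Printing Implicit Defensive.
Import GroupScope.

Section Defs.
Variable gT : finGroupType.

Definition k2' (G : {set gT}) : nat := #|[set x ^: G | x in G & odd #[x]]|.

Definition d2' (G : {set gT}) : rat := ((k2' G)%:R / (#|G|`_(2^')%N)%:R)%R.

(* A normal series 1 = G_0 <= G_1 <= ... <= G_n = G, encoded by s = [G_1; ...; G_n],
   with every G_i normal in G and every factor G_{i+1}/G_i a 2-group or a 2'-group. *)
Definition two_series_step (A B : {group gT}) : bool :=
  (A \subset B) && ((2%N).-group (B / A) || (2^')%N.-group (B / A)).

Definition two_series (G : {group gT}) (s : seq {group gT}) : bool :=
  [&& path two_series_step 1%G s, last 1%G s :==: G & all (fun A : {group gT} => A <| G) s].

(* number of factors in the series that are 2-groups (trivial factors are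
   counted as 2'-groups, which is harmless since we minimize) *)
Definition two_factors (s : seq {group gT}) : nat :=
  count (fun AB : {group gT} * {group gT} => ~~ (2^')%N.-group (AB.2 / AB.1))
        (zip (1%G :: s) s).

Definition two_length_le (G : {group gT}) (n : nat) : Prop :=
  exists s : seq {group gT}, two_series G s /\ two_factors s <= n.

End Defs.

(* Main.v *)
Require Import Defs.
From mathcomp Require Import all_boot all_order all_algebra all_fingroup all_solvable.
From mathcomp Require Import all_field all_character zify.
Set Implicit Arguments. Unset Strict Implicit. Unset Printing Implicit Defensive.
Import GroupScope.

(** Write [k] for the number of classes of odd elements and [h] for the odd part
    of the order.

    Counting commuting pairs [(x, y)] with [x] odd gives
    [k(G) <= k(N) k(G / N)], so [k / h] is bounded by its values on composition
    factors, and equality forces [x ^: G = x ^: N] for odd [x] in [N].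

    For a nonabelian simple [G] with Sylow 2-subgroup [P], consider the
    permutation module [V] on [G / P], of dimension [h], over an algebraically
    closed field of characteristic 2.  Every irreducible module embeds in [V]
    because [P] fixes a nonzero functional, and there are at least [k]
    irreducible modules because traces separate the odd classes.  If [A] is the
    socle of [V] then [h = dim A + dim A^perp], and a nontrivial isotypic
    component of [A] of dimension 2 or 3 lies in [A^perp]; thus [4 k <= h + 3].
    This gives [15 k < 4 h] unless [h] is 15, 21, 33 or 45.  For the last three
    values every odd element has prime power order, since otherwise a class would
    have prime power size, and the bound on [k] improves; for [h = 15] the group
    has a subgroup of index 5 and is [A_5].

    In the case of equality with trivial [O_2(G)], the solvable radical is
    central of odd order, the quotient by it is [A_5] by rigidity of the odd
    classes of its minimal normal subgroup, and transfer splits the extension.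

    For the 2-length, when [O_2(G) = 1] and [B / Y] is [O_2(G / Y)] with
    [Y = O_2'(G) != G], a 2-element acts nontrivially on [Y], whence
    [k(B) / h(B) <= 2 / 3]; since [(2 / 3) ^ 4 < 4 / 15], induction gives
    2-length at most 3 for [G / O_2(G)]. *)

(** * Modular representations *)

Section ModularRepresentations.
Import GRing.Theory.
Local Open Scope ring_scope.

Lemma mxtrace_sub_fact (F : fieldType) n (U A : 'M[F]_n) :
  \tr A = \tr (in_submod U (val_submod 1%:M *m A))
          + \tr (in_factmod U (val_factmod 1%:M *m A)).
Proof.
rewrite [in_submod _ _]in_submodE -mulmxA mxtrace_mulC -val_submodE addrC.
rewrite [in_factmod _ _]in_factmodE -mulmxA mxtrace_mulC -val_factmodE addrC.
by rewrite -in_submodE -in_factmodE -mxtraceD add_sub_fact_mod.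
Qed.

(** Stated for one matrix stabilising [U], so that it applies to an endomorphism commuting with a
    group as well as to group elements. *)
Lemma in_factmod_stable (F : fieldType) n (U A : 'M[F]_n) m (W : 'M_(m, n)) :
    (U *m A <= U)%MS ->
  in_factmod U (W *m A) = in_factmod U W *m in_factmod U (val_factmod 1%:M *m A).
Proof.
move=> sUA; rewrite -{1}[W](add_sub_fact_mod U) mulmxDl linearD /=.
apply: (canLR (subrK _)); apply: etrans (_ : 0 = _).
  apply/eqP; rewrite in_factmod_eq0 (submx_trans _ sUA) //.
  by rewrite submxMr ?val_submodP.
by rewrite /in_factmod /val_factmod /= !mulmxA mulmx1 ?subrr.
Qed.

Lemma closed_field_eigenvalue (F : closedFieldType) n (A : 'M[F]_n) :
  (0 < n)%N -> exists a, eigenvalue A a.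
Proof.
case: n A => // n A _.
have /closed_rootP[a]: size (mxminpoly A) != 1.
  by rewrite size_mxminpoly eqSS -lt0n mxminpoly_nonconstant.
by rewrite -eigenvalue_root_min; exists a.
Qed.

(** * Traces of endomorphisms and irreducible traces *)

Section TraceSpan.

Variables (F : closedFieldType) (gT : finGroupType) (G : {group gT}).
Variables (I : finType) (tau : I -> gT -> F) (k : nat) (c : 'I_k -> gT).
Hypothesis Gc : forall j, c j \in G.
Hypothesis irr_tau : forall n (rG : mx_representation F G n),
  mx_irreducible rG -> exists i, forall x, x \in G -> \tr (rG x) = tau i x.

Let T := \matrix_(i < #|I|, j < k) tau (enum_val i) (c j).

(** An eigenspace of [E] is a submodule because [E] commutes with [G]. A simple [M] inside it
    contributes [a] times an irreducible trace row, and induction applies to the quotient by [M]. A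
    general [E] is allowed because the one used later isolates a single class. *)
Lemma mxtrace_cent_span n (rG : mx_representation F G n) (E : 'M_n) :
  centgmx rG E -> (\row_j \tr (rG (c j) *m E) <= T)%MS.
Proof.
have [m] := ubnP n; elim: m n rG E => // m IHm [|n] rG E ltnm cGE.
  by rewrite (_ : \row_j _ = 0) ?sub0mx //; apply/rowP=> j; rewrite !mxE /mxtrace big_ord0.
have [a] := closed_field_eigenvalue E isT; set K := eigenspace E a => nzK.
have modK: mxmodule rG K.
  apply: kermx_centg_module; apply/centgmxP=> x Gx.
  by rewrite mulmxBl mulmxBr (centgmxP cGE) // scalar_mxC.
apply: (mxsimple_exists modK nzK) => [[M simM sMK]].
have [modM nzM _] := simM.
have ME m1 (W : 'M_(m1, _)): (W <= M)%MS -> W *m E = a *: W.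
  by move=> sWM; apply/eigenspaceP/(submx_trans sWM).
have sMEM: (M *m E <= M)%MS by rewrite ME // scalemx_sub.
pose E' : 'M_(\rank (cokermx M)) := in_factmod M (val_factmod 1%:M *m E).
have [i tr_i] := irr_tau ((submod_mx_irr modM).2 simM).
have cGE': centgmx (factmod_repr modM) E'.
  apply/centgmxP=> x Gx /=.
  rewrite -[in RHS]in_factmod_stable // -in_factmodJ //.
  by rewrite -!mulmxA (centgmxP cGE).
have ltr: (\rank (cokermx M) < m)%N.
  rewrite ltnS in ltnm; rewrite mxrank_coker; apply: leq_trans ltnm.
  by rewrite ltn_subrL lt0n mxrank_eq0 nzM.
have:= IHm _ (factmod_repr modM) _ ltr cGE'.
set r' := \row_j _ => r'T.
suffices ->: \row_j \tr (rG (c j) *m E) = a *: row (enum_rank i) T + r'.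
  by rewrite addmx_sub ?scalemx_sub ?row_sub.
apply/rowP=> j; rewrite !mxE enum_rankK (mxtrace_sub_fact M); congr (_ + _).
  rewrite mulmxA ME ?mxmodule_trans ?val_submodP //.
  by rewrite linearZ mxtraceZ -tr_i.
by rewrite mulmxA in_factmod_stable.
Qed.

End TraceSpan.

(** * Permutation matrices and permutation modules *)

Section ActMx.
Variables (F : fieldType) (T : finType).
Implicit Types (X Y Z : {set T}) (f g : T -> T).

(** A point sent outside [Y] gives a zero row. Taking [f = id] between different sets yields
    inclusion matrices, used for the span of an orbit. *)
Definition act_mx X Y f : 'M[F]_(#|X|, #|Y|) :=
  \matrix_(i, j) (f (enum_val i) == enum_val j)%:R.

Lemma eq_act_mx X Y f g : {in X, f =1 g} -> act_mx X Y f = act_mx X Y g.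
Proof. by move=> eq_fg; apply/matrixP=> i j; rewrite !mxE eq_fg ?enum_valP. Qed.

Lemma mul_act_mx X Y f m (A : 'M_(#|Y|, m)) i j k :
  f (enum_val i) = enum_val j -> (act_mx X Y f *m A) i k = A j k.
Proof.
move=> def_j; rewrite mxE (bigD1 j) //= mxE def_j eqxx mul1r.
rewrite big1 ?addr0 // => l ne_l; rewrite mxE def_j (inj_eq enum_val_inj).
by rewrite eq_sym (negPf ne_l) mul0r.
Qed.

Lemma act_mxM X Y Z f g :
  {in X, forall x, f x \in Y} -> act_mx X Y f *m act_mx Y Z g = act_mx X Z (g \o f).
Proof.
move=> fX; apply/matrixP=> i j; have Yi := fX _ (enum_valP i).
rewrite (@mul_act_mx _ _ _ _ _ _ (enum_rank_in Yi (f (enum_val i)))).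
  by rewrite !mxE enum_rankK_in.
by rewrite enum_rankK_in.
Qed.

Lemma act_mx_id X : act_mx X X id = 1%:M.
Proof. by apply/matrixP=> i j; rewrite !mxE (inj_eq enum_val_inj). Qed.

Lemma mxtrace_act_mx X f : \tr (act_mx X X f) = #|[set x in X | f x == x]|%:R.
Proof.
rewrite -[in RHS]sum1_card natr_sum.
rewrite (eq_bigl (fun x => (x \in X) && (f x == x))) => [|x]; last by rewrite inE.
rewrite big_mkcondr /= big_enum_val /=; apply: eq_bigr => i _.
by rewrite mxE; case: eqP.
Qed.

End ActMx.

Section PermRepr.
Variables (F : fieldType) (gT : finGroupType) (G : {group gT}) (T : finType).
Variables (to : {action gT &-> T}) (X : {set T}).
Hypothesis actsX : [acts G, on X | to].

Lemma perm_mx_repr_subproof : mx_repr G (fun g => act_mx F X X (to^~ g)).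
Proof.
split=> [|g h Gg Gh].
  by rewrite -act_mx_id; apply: eq_act_mx => x _ /=; rewrite act1.
rewrite act_mxM => [|x Xx]; last by rewrite (acts_act actsX).
by apply: eq_act_mx => x _ /=; rewrite actM.
Qed.

Definition perm_repr := MxRepresentation perm_mx_repr_subproof.

Lemma trmx_perm_repr g : (perm_repr g)^T = perm_repr g^-1%g.
Proof.
apply/matrixP=> i j; rewrite !mxE; congr (_%:R); congr nat_of_bool.
by apply/eqP/eqP=> <-; rewrite ?actK ?actKV.
Qed.

Lemma perm_repr_fix_const (c : 'cV[F]_#|X|) i j :
    {in G, forall g, perm_repr g *m c = c} ->
  enum_val j \in orbit to G (enum_val i) -> c i 0 = c j 0.
Proof.
by move=> fix_c /orbitP[g Gg def_j]; rewrite -{1}(fix_c g Gg) (mul_act_mx _ _ def_j).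
Qed.

End PermRepr.

(* Left multiplication by [x^-1] on the cosets of [Q] is an endomorphism of the
   permutation module; composed with an odd element [y], its trace vanishes unless
   [y] is conjugate to [x], where it is the odd number [#|'C_G[x] : Q|]. *)
Section ClassIndicator.
Local Open Scope group_scope.
Variables (F : fieldType) (gT : finGroupType) (G : {group gT}).
Hypothesis char2 : 2%N \in [pchar F].
Variable x : gT.
Hypotheses (Gx : x \in G) (odd_x : odd #[x]).
Variable Q : {group gT}.
Hypothesis sylQ : 2.-Sylow('C_G[x]) Q.

Let X := rcosets Q G.
Let rX := perm_repr F (actsRs_rcosets Q G).
Let lx (A : {set gT}) := (x^-1 *: A)%g.

Let sQC : Q \subset 'C_G[x]. Proof. exact: pHall_sub sylQ. Qed.

(** Left multiplication preserves right cosets of [Q] because [x] centralises [Q]. *)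
Let lxQ g : lx (Q :* g) = Q :* (x^-1 * g).
Proof.
have nQx: (x^-1)%g \in 'N(Q).
  rewrite groupV; apply: (subsetP (cent_sub _)).
  by rewrite -sub_cent1; apply: subset_trans sQC (subsetIr _ _).
by rewrite /lx mulgA -(norm_rlcoset nQx) rcosetM.
Qed.

Lemma lmul_rcosets_cent : centgmx rX (act_mx F X X lx).
Proof.
have lX: {in X, forall A, lx A \in X}.
  by move=> _ /rcosetsP[g Gg ->]; rewrite lxQ -rcosetE imset_f ?groupM ?groupV.
apply/centgmxP=> g Gg; rewrite !act_mxM //; last first.
  by move=> A XA; rewrite /= (acts_act (actsRs_rcosets _ _)).
by apply: eq_act_mx => A _ /=; rewrite !rcosetE /lx mulgA.
Qed.

(** If the coset is fixed then [y ^ g^-1 = x * q] with [q] in [Q] commuting with [x]. Since [x] and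
    [y] have odd order, so does [q]; being a 2-element, it is 1. *)
Lemma fix_rcosets_class y g : y \in G -> odd #[y] -> g \in G ->
  (lx (Q :* g :* y) == Q :* g) = (x ^ g == y)%g.
Proof.
move=> Gy odd_y Gg; rewrite -rcosetM lxQ; apply/eqP/eqP=> [eqQ | <-]; last first.
  by rewrite conjgE mulKVg mulKg.
have: (x^-1 * (g * y) \in Q :* g)%g by rewrite -eqQ rcoset_refl.
case/rcosetP=> q Qq def_q.
have [_ /cent1P cxq] := setIP (subsetP sQC q Qq).
have def_y: (y ^ g^-1 = x * q)%g.
  by rewrite conjgE invgK mulgA -[(g * y)%g](mulKVg x) def_q mulgA mulgK.
suffices q1: q = 1%g by rewrite -[y](conjgK g^-1) invgK def_y q1 mulg1.
apply/eqP; rewrite -order_eq1.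
have: q ^+ (#[x] * #[y]) = 1.
  have: (x * q) ^+ (#[x] * #[y]) = 1.
    by rewrite -def_y mulnC expgM -conjXg expg_order conj1g expg1n.
  by rewrite expgMn // {1}expgM expg_order expg1n mul1g.
move/eqP; rewrite -order_dvdn => dv_q.
have odd_q: odd #[q] by apply: dvdn_odd dv_q _; rewrite oddM odd_x odd_y.
have p_q: 2%N.-nat #[q] := mem_p_elt (pHall_pgroup sylQ) Qq.
by apply/eqP/(pnat_1 p_q); rewrite -odd_2'nat.
Qed.

Lemma trace_class_indicator y : y \in G -> odd #[y] ->
  (\tr (rX y *m act_mx F X X lx) = #|[set A in X | lx (A :* y)%g == A]|%:R)%R.
Proof.
move=> Gy odd_y; rewrite act_mxM; last first.
  by move=> A XA; rewrite /= (acts_act (actsRs_rcosets _ _)).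
by rewrite mxtrace_act_mx; congr (_%:R); apply: eq_card => A; rewrite !inE /= rcosetE.
Qed.

Lemma trace_class_indicator0 y : y \in G -> odd #[y] -> y \notin x ^: G ->
  (\tr (rX y *m act_mx F X X lx) = 0)%R.
Proof.
move=> Gy odd_y nxy; rewrite trace_class_indicator // (_ : [set A in X | _] = set0) ?cards0 //.
apply/setP=> A; rewrite !inE; apply/andP=> [[/rcosetsP[g Gg ->]]].
by rewrite fix_rcosets_class // => /eqP def_y; rewrite -def_y imset_f in nxy.
Qed.

Lemma trace_class_indicator1 : (\tr (rX x *m act_mx F X X lx) != 0)%R.
Proof.
rewrite trace_class_indicator // (_ : [set A in X | _] = rcosets Q 'C_G[x]).
  rewrite -(dvdn_pcharf char2) dvdn2 negbK odd_2'nat.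
  by case/and3P: sylQ.
apply/setP=> A; rewrite !inE; apply/andP/rcosetsP=> [[/rcosetsP[g Gg ->]] | [g]].
  rewrite fix_rcosets_class // => /eqP/conjg_fixP/commgP/cent1P cxg.
  by exists g; rewrite // inE Gg cent1C.
case/setIP=> Gg; rewrite cent1C => /cent1P cgx ->.
rewrite -{1}rcosetE imset_f // fix_rcosets_class //.
by split=> //; apply/eqP/conjg_fixP/commgP.
Qed.

End ClassIndicator.

Section CardIrr.
Variables (F : closedFieldType) (gT : finGroupType) (G : {group gT}).
Variables (I : finType) (tau : I -> gT -> F).
Hypothesis char2 : 2%N \in [pchar F].
Hypothesis irr_tau : forall n (rG : mx_representation F G n),
  mx_irreducible rG -> exists i, forall x, x \in G -> \tr (rG x) = tau i x.

(** The table [T] of irreducible traces has [#|I|] rows and one column per odd class. The class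
    indicators put every unit row vector in its row space, so its rank is the number of columns. *)
Lemma k2'_le_irr : (k2' G <= #|I|)%N.
Proof.
rewrite /k2'; set K := [set _ | _ in _ & _].
pose c (j : 'I_#|K|) := repr (enum_val j).
have cP j : [/\ c j \in G, odd #[c j] & enum_val j = c j ^: G].
  have /imsetP[x /[!inE]/andP[Gx odd_x] def_j] := enum_valP j.
  have /imsetP[y Gy def_c]: c j \in x ^: G.
    by rewrite /c def_j (mem_repr x) ?class_refl.
  by rewrite def_c groupJ // orderJ classGidl.
have Gc j : c j \in G by have [] := cP j.
have := mxtrace_cent_span Gc irr_tau.
set T := \matrix_(i, j) _ => sT.
suffices: (1%:M <= T)%MS.
  by move/mxrankS; rewrite mxrank1 => /leq_trans-> //; apply: rank_leq_row.
apply/row_subP=> j; have [_ odd_j def_j] := cP j.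
have [Q sylQ] := Sylow_exists 2 'C_G[c j].
have := sT _ _ _ (lmul_rcosets_cent F (Gc j) sylQ).
have:= trace_class_indicator1 char2 (Gc j) odd_j sylQ.
set E := act_mx _ _ _ _; set rX := perm_repr _ _; set a := \tr _ => nz_a.
set r := \row_i _ => sr; suffices ->: row j 1%:M = a^-1 *: r.
  exact: scalemx_sub.
apply/rowP=> i; rewrite !mxE; have [<- | ne_ji] := eqVneq j i.
  by rewrite mulVf.
have [_ odd_i def_i] := cP i; rewrite trace_class_indicator0 ?mulr0 //.
apply: contra ne_ji => /class_eqP; rewrite -def_i -def_j => /enum_val_inj->.
by rewrite eqxx.
Qed.

End CardIrr.

Section PgroupFix.
Variables (F : fieldType) (p : nat) (gT : finGroupType) (G P : {group gT}).
Hypotheses (charFp : p \in [pchar F]) (pP : p.-group P) (sPG : P \subset G).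
Variables (n : nat) (rG : mx_representation F G n).

Lemma pgroup_fix_submod (U : 'M_n) :
  mxmodule (subg_repr rG sPG) U -> U != 0 -> (U :&: rfix_mx rG P)%MS != 0.
Proof.
move=> modU nzU; have r_gt0: (0 < \rank U)%N by rewrite lt0n mxrank_eq0.
have:= rfix_pgroup_pchar charFp (submod_repr modU) r_gt0 pP (subxx P).
apply: contraNneq => cap0.
by rewrite -submx0 (rfix_submod modU) ?subxx // rfix_subg cap0 linear0 sub0mx.
Qed.

Lemma dual_mx_repr : mx_repr G (fun g => (rG g^-1%g)^T).
Proof.
split=> [|x y Gx Gy]; first by rewrite invg1 repr_mx1 trmx1.
by rewrite invMg repr_mxM ?groupV // trmx_mul.
Qed.
Definition dual_repr := MxRepresentation dual_mx_repr.

End PgroupFix.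

(** Columns are functionals on row vectors. Those vanishing on [M] form a nonzero [P]-submodule of
    the dual, in which a p-group in characteristic p fixes a nonzero vector. *)
Lemma pgroup_fix_functional (F : fieldType) p (gT : finGroupType)
    (G P : {group gT}) n (rG : mx_representation F G n) m (M : 'M_(m, n)) :
    p \in [pchar F] -> p.-group P -> P \subset G ->
    {in P, forall g, M *m rG g <= M}%MS -> ~~ row_full M ->
  exists c : 'cV_n, [/\ c != 0, M *m c = 0 & {in P, forall g, rG g *m c = c}].
Proof.
move=> charFp pP sPG stM; rewrite -col_leq_rank -ltnNge => ltM.
pose K := kermx M^T; pose rD := dual_repr rG.
have nzK: K != 0.
  by rewrite -mxrank_eq0 mxrank_ker mxrank_tr -lt0n subn_gt0.
have modK: mxmodule (subg_repr rD sPG) K.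
  apply/mxmoduleP=> g Pg; apply/sub_kermxP; rewrite -mulmxA -trmx_mul.
  have /submxP[A ->] := stM g^-1%g (groupVr Pg).
  by rewrite trmx_mul mulmxA mulmx_ker mul0mx.
have /rowV0Pn[u] := pgroup_fix_submod charFp pP modK nzK.
rewrite sub_capmx => /andP[/sub_kermxP uM0 /rfix_mxP fix_u] nz_u.
exists u^T; split=> [||g Pg].
- by rewrite -(inj_eq trmx_inj) trmxK trmx0.
- by apply: trmx_inj; rewrite trmx_mul trmxK uM0 trmx0.
by apply: trmx_inj; rewrite trmx_mul trmxK -{2}(fix_u _ (groupVr Pg)) /= invgK.
Qed.

(** * The permutation module on the cosets of a Sylow 2-subgroup *)

Section CosetModule.
Variables (F : closedFieldType) (gT : finGroupType) (G P : {group gT}).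
Hypotheses (char2 : 2%N \in [pchar F]) (sylP : 2.-Sylow(G) P).

Let sPG : P \subset G. Proof. exact: pHall_sub sylP. Qed.
Let pP : 2.-group P. Proof. exact: pHall_pgroup sylP. Qed.

Local Notation X := (rcosets P G).
Local Notation h := #|X|.
Let rV := perm_repr F (actsRs_rcosets P G).

Let XP : gval P \in X. Proof. by rewrite -{1}[gval P]rcoset1 -rcosetE imset_f. Qed.
Let ix (A : {set gT}) : 'I_h := enum_rank_in XP A.
Let ixK : {in X, cancel ix enum_val}. Proof. exact: enum_rankK_in. Qed.
(** The functional evaluating at the coset [P]. *)
Let e0 : 'cV[F]_h := delta_mx (ix P) 0.

Lemma coset_repr_e0 g : g \in P -> rV g *m e0 = e0.
Proof.
move=> Pg; have Gg := subsetP sPG g Pg; apply/colP=> i.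
have Xi: 'Rs%act (enum_val i) g \in X.
  by rewrite (acts_act (actsRs_rcosets _ _)) ?enum_valP.
rewrite (@mul_act_mx _ _ _ _ _ _ _ _ (ix ('Rs%act (enum_val i) g))) ?ixK //.
rewrite !mxE !andbT -!(inj_eq enum_val_inj) !ixK //=; congr (_%:R); congr nat_of_bool.
rewrite rcosetE; apply/eqP/eqP=> [iP | ->]; last by rewrite rcoset_id.
by rewrite -[enum_val i](rcosetK g) iP rcoset_id ?groupV.
Qed.

Section Hom.
Variables (n : nat) (rG : mx_representation F G n) (c : 'cV[F]_n).
Hypothesis fix_c : {in P, forall g, rG g *m c = c}.

Let f A : 'cV_n := rG (repr A)^-1%g *m c.
(** Frobenius reciprocity: the homomorphism into the coset module attached to the [P]-fixed
    functional [c]. Its coordinate at [P :* g] is the functional [rG g^-1 *m c], independent of the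
    representative because [P] fixes [c]. *)
Definition coset_hom_mx : 'M_(n, h) := \matrix_(i, j) f (enum_val j) i 0.

Let fE g : g \in G -> f (P :* g)%g = rG g^-1%g *m c.
Proof.
rewrite /f; case: repr_rcosetP => y Py Gg.
have Gy := subsetP sPG y Py; rewrite invMg repr_mxM ?groupV // -mulmxA.
by rewrite fix_c ?groupV.
Qed.

Lemma coset_hom_mxJ g : g \in G -> rG g *m coset_hom_mx = coset_hom_mx *m rV g.
Proof.
move=> Gg; rewrite -[rV g]trmxK trmx_perm_repr; apply/matrixP=> i j; rewrite !mxE.
have /rcosetsP[y Gy def_j] := enum_valP j.
have Xyg: (P :* (y * g^-1))%g \in X by rewrite -rcosetE imset_f ?groupM ?groupV.
rewrite [RHS](bigD1 (ix (P :* (y * g^-1))%g)) //=.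
rewrite [X in _ + X]big1 ?addr0 => [|l ne_l]; last first.
  rewrite !mxE def_j rcosetE -rcosetM; case: eqP => [def_l | _]; last by rewrite mulr0.
  by case/eqP: ne_l; apply: enum_val_inj; rewrite ixK.
rewrite [coset_hom_mx _ _]mxE ixK // fE ?groupM ?groupV // [_^T _ _]mxE.
rewrite [act_mx _ _ _ _ _ _]mxE ixK // def_j rcosetE -rcosetM eqxx mulr1.
rewrite invMg invgK repr_mxM ?groupV // -mulmxA -fE // [RHS]mxE.
by apply: eq_bigr => l _; rewrite [coset_hom_mx _ _]mxE def_j.
Qed.

Lemma coset_hom_mx_e0 : coset_hom_mx *m e0 = c.
Proof.
have f1: f P = c by rewrite -[X in f X]rcoset1 fE // invg1 repr_mx1 mul1mx.
apply/colP=> i; rewrite [LHS]mxE (bigD1 (ix P)) //= [delta_mx _ _ _ _]mxE !eqxx mulr1.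
rewrite big1 => [|j /negPf ne_j]; last by rewrite [delta_mx _ _ _ _]mxE ne_j mulr0.
by rewrite addr0 [coset_hom_mx _ _]mxE ixK // f1.
Qed.

Hypotheses (irrG : mx_irreducible rG) (nz_c : c != 0).

(** The kernel is a submodule, proper because composing with [e0] recovers [c]. *)
Lemma coset_hom_mx_free : row_free coset_hom_mx.
Proof.
have [_ irr] := (mx_irrP rG).1 irrG; rewrite -kermx_eq0; apply: contraTT isT => nzK.
have modK: mxmodule rG (kermx coset_hom_mx).
  apply/mxmoduleP=> g Gg; apply/sub_kermxP.
  by rewrite -mulmxA coset_hom_mxJ // mulmxA mulmx_ker mul0mx.
case/negP: nz_c; rewrite -coset_hom_mx_e0 -[coset_hom_mx]mul1mx.
have:= irr _ modK nzK; rewrite -sub1mx => /sub_kermxP->.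
by rewrite mul0mx.
Qed.

Lemma coset_hom_mx_module : mxmodule rV <<coset_hom_mx>>%MS.
Proof.
rewrite (eqmx_module _ (genmxE _)); apply/mxmoduleP=> g Gg.
by rewrite -coset_hom_mxJ ?submxMl.
Qed.

Lemma coset_hom_mx_rsim : mx_rsim rG (submod_repr coset_hom_mx_module).
Proof.
set M := <<_>>%MS; pose B := in_submod M coset_hom_mx.
have sM: (coset_hom_mx <= M)%MS by rewrite genmxE.
exists B => [||g Gg].
- by rewrite genmxE; apply/esym/eqP/coset_hom_mx_free.
- by rewrite /row_free mxrank_in_submod //; apply: coset_hom_mx_free.
rewrite -in_submodJ // -coset_hom_mxJ //.
by rewrite [RHS]in_submodE -mulmxA -in_submodE.
Qed.

Lemma coset_hom_mx_simple : mxsimple rV <<coset_hom_mx>>%MS.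
Proof.
by apply/(submod_mx_irr coset_hom_mx_module); apply: mx_rsim_irr coset_hom_mx_rsim _.
Qed.

End Hom.

(** A nonzero functional fixed by the 2-group [P] exists, so Frobenius reciprocity embeds the
    irreducible module in the coset module. *)
Lemma irr_trace_coset_socle (sV : socleType rV) n (rG : mx_representation F G n) :
    mx_irreducible rG ->
  exists W : sV, forall x, x \in G -> \tr (rG x) = \tr (socle_repr W x).
Proof.
move=> irrG; have [n_gt0 _] := (mx_irrP rG).1 irrG.
have [||c [nz_c _ fix_c]] := @pgroup_fix_functional F 2 gT G P n rG n 0 char2 pP sPG.
- by move=> g _; rewrite mul0mx.
- by rewrite /row_full mxrank0 eq_sym -lt0n.
have [W isoW] := Socle_iso sV (coset_hom_mx_simple fix_c irrG nz_c).
exists W => x Gx; rewrite (mxtrace_rsim (coset_hom_mx_rsim fix_c irrG nz_c)) //.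
apply/esym/mxtrace_rsim => //; apply/mx_rsim_iso; exact: isoW.
Qed.

Local Notation Ub U := (@val_submod F h U _ 1%:M).

Section Summand.
Variable U : 'M[F]_h.
Hypotheses (simU : mxsimple rV U) (compU : (component_mx rV U <= U)%MS).
Let modU := mxsimple_module simU.
Let rU := submod_repr modU.

(** The homomorphism attached to [c] has image in the isotypic component of [U], which is [U]
    itself, so it is a scalar by Schur's lemma; composing with [e0] identifies [c]. *)
Lemma coset_functional_uniq (c : 'cV_(\rank U)) :
  {in P, forall g, rU g *m c = c} -> exists a, c = a *: (Ub U *m e0).
Proof.
move=> fix_c; have irrU : mx_irreducible rU by apply/submod_mx_irr.
have [-> | nz_c] := eqVneq c 0; first by exists 0; rewrite scale0r.
pose Th := coset_hom_mx rU c.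
have isoU: mx_iso rV U <<Th>>%MS.
  by have /mx_rsim_iso := coset_hom_mx_rsim fix_c irrU nz_c.
have sThU: (Th <= U)%MS.
  rewrite -genmxE; exact: submx_trans (mx_iso_component simU isoU) compU.
have cA: centgmx rU (in_submod U Th).
  apply/centgmxP=> g Gg; rewrite -in_submodJ // -coset_hom_mxJ //.
  by rewrite [LHS]in_submodE -mulmxA -in_submodE.
have absU := group_closure_closed_field irrU.
have /is_scalar_mxP[a defA] := mx_abs_irr_cent_scalar absU cA.
exists a; rewrite -[LHS](coset_hom_mx_e0 fix_c) -/Th -(in_submodK sThU) defA.
by rewrite val_submodE mul_scalar_mx scalemxAl.
Qed.

Variable Pi : 'M[F]_h.
Hypotheses (cPi : centgmx rV Pi) (sPiU : (Pi <= U)%MS) (UPi : U *m Pi = U).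

(** [l] is evaluation at [P] restricted to [U], and [r] extends it to the whole module through the
    projection [Pi]. *)
Let l := Ub U *m e0.
Let r := Pi *m e0.

Let nz_l : l != 0.
Proof.
have [_ nzU _] := simU.
have [||c [nz_c _ fix_c]] := @pgroup_fix_functional F 2 gT G P _ rU 1 0 char2 pP sPG.
- by move=> g _; rewrite mul0mx.
- by rewrite /row_full mxrank0 eq_sym mxrank_eq0.
have [a def_c] := coset_functional_uniq fix_c.
by apply: contraNneq nz_c => l0; rewrite def_c -/l l0 scaler0.
Qed.

Let Ur : Ub U *m r = l.
Proof.
rewrite mulmxA; congr (_ *m _).
have /submxP[D ->]: (Ub U <= U)%MS by exact: val_submodP.
by rewrite -mulmxA UPi.
Qed.

Let fix_r : {in P, forall g, rV g *m r = r}.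
Proof.
by move=> g Pg; rewrite mulmxA -(centgmxP cPi) ?(subsetP sPG) // -mulmxA coset_repr_e0.
Qed.

Let actsPX : [acts P, on X | 'Rs].
Proof. exact: subset_trans sPG (actsRs_rcosets P G). Qed.

(** Being [P]-fixed, [r] is constant on [P]-orbits, so [l] is the sum over orbits of this constant
    times the orbit sum restricted to [U]. As [l] is nonzero, some orbit has both factors
    nonzero. *)
Let orbit_exists : exists2 i, r i 0 != 0 &
  \sum_(j | enum_val j \in orbit 'Rs P (enum_val i)) col j (Ub U) != 0.
Proof.
apply/exists_inP; apply: contraNT nz_l => /exists_inPn no_i; rewrite -Ur.
pose s (A : {set gT}) : 'cV_(\rank U) := r (ix A) 0 *: col (ix A) (Ub U).
have ->: Ub U *m r = \sum_(A in X) s A.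
  rewrite big_enum_val /=; apply/colP=> i; rewrite mxE summxE.
  by apply: eq_bigr => j _; rewrite !mxE /ix enum_valK_in mulrC.
rewrite (set_partition_big _ (orbit_partition actsPX)) /= big1 // => O.
case/imsetP=> A XA ->; set O' := orbit _ _ _.
have sO'X: O' \subset X by rewrite acts_sub_orbit.
have [rA0 | nz_rA] := eqVneq (r (ix A) 0) 0.
  rewrite big1 // => B O'B; rewrite /s -(@perm_repr_fix_const _ _ _ _ _ _ actsPX r (ix A)) //.
    by rewrite rA0 scale0r.
  by rewrite !ixK // (subsetP sO'X).
have /negbNE/eqP sum0 := no_i (ix A) nz_rA.
rewrite (eq_bigr (fun B => r (ix A) 0 *: col (ix B) (Ub U))) => [|B O'B]; last first.
  rewrite /s (@perm_repr_fix_const _ _ _ _ _ _ actsPX r (ix A) (ix B)) //.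
  by rewrite !ixK // (subsetP sO'X).
rewrite -scaler_sumr (_ : \sum_(B in O') _ = 0) ?scaler0 //.
rewrite ixK // -/O' in sum0; apply: etrans sum0; rewrite -{1}(setIidPr sO'X).
rewrite (eq_bigl (fun B => (B \in X) && (B \in O'))) => [|B]; last by rewrite inE.
by rewrite big_enum_val_cond /=; apply: eq_bigr => j _; rewrite /ix enum_valK_in.
Qed.

(** For the orbit [O] just found, the permutation module on [O] embeds in the dual of [U] and maps
    onto [U] under [Pi]; this gives both inequalities between [#|O|] and [\rank U]. An element
    acting trivially on [O] then acts trivially on its image [U]. *)
Lemma coset_summand_orbit : exists A : {set gT},
  [/\ A \in X, #|orbit 'Rs P A| = \rank U
    & forall g, g \in P -> {in orbit 'Rs P A, forall B, B :* g = B} -> U *m rV g = U].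
Proof.
have [i nz_ri nz_sum] := orbit_exists; pose A : {set gT} := enum_val i.
exists A; have XA : A \in X by apply: enum_valP.
pose O := orbit 'Rs P A; have sOX: O \subset X by rewrite acts_sub_orbit.
have actsO: [acts P, on O | 'Rs] by rewrite acts_orbit ?subsetT.
pose rO := perm_repr F actsO; pose N := act_mx F O X id.
have NJ g: g \in P -> N *m rV g = rO g *m N.
  move=> Pg; rewrite act_mxM => [|B OB]; last exact: (subsetP sOX).
  rewrite act_mxM => [|B OB]; last by rewrite /= (acts_act actsO).
  exact: eq_act_mx.
have OA: A \in O by apply: orbit_refl.
(* A nonzero kernel would contain a nonzero [P]-fixed vector, that is a multiple of the sum of [O];
   but this sum does not vanish on [U]. *)
have free_NU: row_free (N *m (Ub U)^T).
  rewrite -kermx_eq0; apply: contraNT nz_sum => nzK.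
  have UJ g: g \in P -> rV g *m (Ub U)^T = (Ub U)^T *m (rU g^-1%g)^T.
    move=> Pg; rewrite -[rV g]trmxK trmx_perm_repr -!trmx_mul -val_submodE.
    by rewrite -[rU _]mul1mx val_submodJ // groupV (subsetP sPG).
  have modK: mxmodule (subg_repr rO (subxx P)) (kermx (N *m (Ub U)^T)).
    apply/mxmoduleP=> g Pg; apply/sub_kermxP; rewrite -mulmxA (mulmxA (rO g)) -NJ //.
    by rewrite -(mulmxA N) UJ // (mulmxA N) (mulmxA (kermx _)) mulmx_ker mul0mx.
  have /rowV0Pn[u] := pgroup_fix_submod char2 pP modK nzK.
  rewrite sub_capmx => /andP[/sub_kermxP uK /rfix_mxP fix_u] nz_u.
  have{}fix_u: {in P, forall g, rO g *m u^T = u^T}.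
    move=> g Pg; apply: trmx_inj; rewrite trmx_mul trmxK trmx_perm_repr.
    by apply: fix_u; rewrite groupV.
  pose i0 := enum_rank_in OA A.
  have u_const j: u 0 j = u 0 i0.
    have:= @perm_repr_fix_const _ _ _ _ _ _ actsO _ i0 j fix_u.
    by rewrite !mxE enum_rankK_in // => ->; rewrite ?enum_valP.
  have nz_u0: u 0 i0 != 0.
    apply: contraNneq nz_u => u0; apply/eqP/rowP=> j; rewrite u_const u0.
    by rewrite mxE.
  rewrite -(inj_eq (scalerI nz_u0)) scaler0; apply/eqP.
  apply: trmx_inj; rewrite trmx0 -[RHS]uK mulmxA; apply/rowP=> k.
  have uN j: (u *m N) 0 j = if enum_val j \in O then u 0 i0 else 0.
    rewrite mxE; case: ifPn => [Oj | O'j]; last first.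
      rewrite big1 // => m _; rewrite mxE; case: eqP => [def_m | _]; last by rewrite mulr0.
      by rewrite -def_m enum_valP in O'j.
    rewrite (bigD1 (enum_rank_in OA (enum_val j))) //= mxE enum_rankK_in // eqxx.
    rewrite mulr1 u_const big1 ?addr0 // => m ne_m; rewrite mxE.
    case: eqP => [def_m | _]; last by rewrite mulr0.
    by case/eqP: ne_m; apply: enum_val_inj; rewrite enum_rankK_in.
  rewrite [RHS]mxE 2![LHS]mxE summxE mulr_sumr big_mkcond /=.
  apply: eq_bigr => j _; rewrite uN !mxE; case: ifP => // _.
  by rewrite mul0r.
pose M := in_submod U (N *m Pi).
have sNPi: (N *m Pi <= U)%MS by rewrite mulmx_sub.
have MJ g: g \in P -> M *m rU g = rO g *m M.
  move=> Pg; rewrite -in_submodJ // -mulmxA (centgmxP cPi) ?(subsetP sPG) //.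
  by rewrite mulmxA NJ // [RHS]mulmxA [LHS]in_submodE -!mulmxA -in_submodE mulmxA.
(* Otherwise a nonzero [P]-fixed functional on [U] kills the image of [O]. It is a multiple of [l],
   which forces [r] to vanish on [O]. *)
have full_M: row_full M.
  apply: contraNT nz_ri => nfull.
  have stM: {in P, forall g, M *m rU g <= M}%MS by move=> g Pg; rewrite MJ // submxMl.
  have [c [nz_c Mc fix_c]] := pgroup_fix_functional char2 pP sPG stM nfull.
  have [a def_c] := coset_functional_uniq fix_c.
  have nz_a: a != 0 by apply: contraNneq nz_c => a0; rewrite def_c a0 scale0r.
  move/eqP: Mc; rewrite def_c -scalemxAr scaler_eq0 (negPf nz_a) /=.
  rewrite mulmxA -val_submodE in_submodK // -mulmxA -/r => /eqP/matrixP Nr0.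
  have:= Nr0 (enum_rank_in OA A) 0; rewrite (@mul_act_mx _ _ _ _ _ _ _ _ i) ?enum_rankK_in //.
  by rewrite [RHS]mxE => ->.
split=> // [|g Pg fixO].
  apply/eqP; rewrite eqn_leq; apply/andP; split.
    rewrite -(eqP free_NU) -/O.
    by apply: leq_trans (mxrankM_maxr _ _) _; rewrite mxrank_tr rank_leq_row.
  by rewrite -(eqP full_M) rank_leq_row.
have rOg: rO g = 1%:M.
  by rewrite /= -act_mx_id; apply: eq_act_mx => B OB /=; rewrite rcosetE fixO.
have rUg: rU g = 1%:M.
  have [M' M'M] := row_fullP full_M.
  by rewrite -[LHS]mul1mx -M'M -mulmxA MJ // rOg mul1mx.
have /submxP[D defU]: (U <= Ub U)%MS by rewrite val_submod1.
apply: etrans (esym defU); rewrite {1}defU -mulmxA -val_submodJ ?(subsetP sPG) //.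
by rewrite [submod_mx _ _]rUg mul1mx.
Qed.

End Summand.

Lemma orthogonal_module (U : 'M[F]_h) : mxmodule rV U -> mxmodule rV (kermx U^T).
Proof.
move=> modU; apply/mxmoduleP=> g Gg; apply/sub_kermxP.
rewrite -mulmxA -[rV g]trmxK trmx_perm_repr -trmx_mul.
have /submxP[A ->] := mxmoduleP modU g^-1%g (groupVr Gg).
by rewrite trmx_mul mulmxA mulmx_ker mul0mx.
Qed.

Lemma simple_form_nondegenerate (U S : 'M[F]_h) m (v : 'M_(m, h)) :
    mxsimple rV U -> mxmodule rV S -> U *m S^T != 0 ->
  (v <= U)%MS -> v *m S^T = 0 -> v = 0.
Proof.
move=> [modU _ simU] modS nzUS sv /sub_kermxP sv'.
have modUS: mxmodule rV (U :&: kermx S^T)%MS.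
  by rewrite capmx_module ?orthogonal_module.
apply/eqP; apply: contraNT nzUS => nz_v; apply/eqP/sub_kermxP.
apply: submx_trans (simU _ modUS (capmxSl _ _) _) (capmxSr _ _).
by apply: contraNneq nz_v => US0; rewrite -submx0 -US0 sub_capmx sv.
Qed.

(** Both modules being simple, the permutation form pairs them perfectly, with invertible matrix
    [D]. Pairing with [S] and then applying the inverse of [D] projects onto [U]. *)
Lemma coset_projection (U S : 'M[F]_h) :
    mxsimple rV U -> mxsimple rV S -> U *m S^T != 0 ->
  exists Pi, [/\ centgmx rV Pi, (Pi <= U)%MS & U *m Pi = U].
Proof.
move=> simU simS nzUS; have [[modU _ _] [modS _ _]] := (simU, simS).
have nzSU: S *m U^T != 0.
  by apply: contraNneq nzUS => SU0; rewrite -[_ *m _]trmxK trmx_mul trmxK SU0 trmx0.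
pose Sb : 'M_(\rank S, h) := val_submod 1%:M.
pose D := Ub U *m Sb^T.
have freeD U1 S1 (simU1 : mxsimple rV U1) (modS1 : mxmodule rV S1) :
  U1 *m S1^T != 0 -> row_free (Ub U1 *m (Ub S1)^T).
  move=> nz1; rewrite -kermx_eq0; set K := kermx _.
  rewrite -(val_submod_eq0 (U := U1)) val_submodE.
  apply/eqP/(simple_form_nondegenerate simU1 modS1 nz1); first by rewrite -val_submodE val_submodP.
  have /submxP[A ->]: (S1 <= Ub S1)%MS by rewrite val_submod1.
  by rewrite trmx_mul mulmxA -(mulmxA K) mulmx_ker mul0mx.
have DV: D *m pinvmx D = 1%:M by rewrite mulmxVp // freeD.
have VD: pinvmx D *m D = 1%:M.
  have := freeD _ _ simS modU nzSU; rewrite -[_ *m _]trmxK trmx_mul trmxK -/Sb -/D.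
  by rewrite /row_free mxrank_tr => fullD; rewrite mulVpmx.
exists (Sb^T *m pinvmx D *m Ub U); split.
- apply/centgmxP=> g Gg; have GgV := groupVr Gg.
  have defU: Ub U *m rV g = submod_mx modU g *m Ub U.
    by rewrite -val_submodE -[submod_mx _ _]mul1mx val_submodJ.
  have defS: rV g *m Sb^T = Sb^T *m (submod_mx modS g^-1%g)^T.
    rewrite -[rV g]trmxK trmx_perm_repr -!trmx_mul -val_submodE.
    by rewrite -[submod_mx _ _]mul1mx val_submodJ.
  have eqD: submod_mx modU g *m D = D *m (submod_mx modS g^-1%g)^T.
    by rewrite /D mulmxA -defU -!mulmxA defS.
  have eqV: pinvmx D *m submod_mx modU g = (submod_mx modS g^-1%g)^T *m pinvmx D.
    move: D DV VD eqD => D DV VD eqD.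
    by rewrite -[LHS]mulmx1 -DV mulmxA -(mulmxA _ _ D) eqD mulmxA VD mul1mx.
  move: (Ub U) defU (Sb^T) defS (pinvmx D) eqV => B defU C defS D' eqV.
  by rewrite -!mulmxA defU (mulmxA D') eqV !mulmxA defS.
- by rewrite mulmx_sub ?val_submodP.
have /submxP[A defU]: (U <= Ub U)%MS by rewrite val_submod1.
apply: etrans (esym defU); rewrite {1}defU; move: DV; rewrite /D.
move: (Ub U) (Sb^T) (pinvmx _) => B C D' DV.
by rewrite !mulmxA -(mulmxA A B) -(mulmxA A (B *m C)) DV mulmx1.
Qed.

End CosetModule.

(** * Counting dimensions in the socle *)

Section SocleBound.
Variables (F : closedFieldType) (gT : finGroupType) (G P : {group gT}).
Hypotheses (char2 : 2%N \in [pchar F]) (sylP : 2.-Sylow(G) P).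
Hypotheses (simG : simple G) (nabG : ~~ abelian G) (oP : #|P| != 2%N).

Local Notation X := (rcosets P G).
Local Notation h := #|X|.
Let rV := perm_repr F (actsRs_rcosets P G).

Let perfG : G^`(1)%g = G.
Proof.
have [_ minG] := simpleP _ simG.
by have [/derG1P/(negP nabG) |] := minG _ (der_normal 1 G).
Qed.

Let orbitX : {in X &, forall A B, B \in orbit 'Rs G A}.
Proof.
by move=> A B; rewrite -orbitRs => XA XB; rewrite (orbit_eqP XA).
Qed.

Let rank_rfix : (\rank (rfix_mx rV G) <= 1)%N.
Proof.
have XP: gval P \in X by rewrite -{1}[gval P]rcoset1 -rcosetE imset_f.
have: (rfix_mx rV G <= (const_mx 1 : 'rV_h))%MS.
  apply/row_subP=> i; have := row_sub i (rfix_mx rV G); set v := row i _.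
  move/rfix_mxP=> fix_v; pose j0 := enum_rank_in XP P.
  have fix_vT: {in G, forall g, rV g *m v^T = v^T}.
    move=> g Gg; apply: trmx_inj; rewrite trmx_mul trmxK trmx_perm_repr.
    by rewrite fix_v ?groupV.
  have ->: v = v 0 j0 *: const_mx 1.
    apply/rowP=> j; rewrite [RHS]mxE [const_mx _ _ _]mxE mulr1.
    have:= @perm_repr_fix_const _ _ _ _ _ _ _ _ j0 j fix_vT.
    by rewrite !mxE => -> //; apply: orbitX; apply: enum_valP.
  exact: scalemx_sub.
by move/mxrankS/leq_trans->; rewrite // rank_leq_row.
Qed.

Lemma coset_linear_fix (U : 'M[F]_h) :
  mxmodule rV U -> \rank U = 1%N -> (U <= rfix_mx rV G)%MS.
Proof.
move=> modU rU1; apply/rfix_mxP=> g Gg.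
have: g \in rstab rV U.
  rewrite -(rker_submod modU); apply: subsetP Gg.
  by rewrite -{1}perfG rker_linear.
by case/setIdP=> _ /eqP.
Qed.

Variable sV : socleType rV.

(** A module of rank 1 is trivial because [G] is perfect, and by transitivity only constant vectors
    are fixed. *)
Lemma coset_linear_uniq (W1 W2 : sV) :
  \rank (socle_base W1) = 1%N -> \rank (socle_base W2) = 1%N -> W1 = W2.
Proof.
have fixW (W : sV) : \rank (socle_base W) = 1%N -> (socle_base W :=: rfix_mx rV G)%MS.
  move=> r1; have s1 := coset_linear_fix (socle_module W) r1.
  by apply/eqmxP; rewrite -(geq_leqif (mxrank_leqif_eq s1)) r1.
move=> /fixW eq1 /fixW eq2; apply/eqP/socle_rsimP/mx_rsim_iso.
exact/eqmx_iso/(eqmx_trans eq1)/eqmx_sym.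
Qed.

(* The orthogonal of the socle for the permutation form. *)
Let Ap := kermx (Socle sV)^T.

(* Otherwise [W] is simple of rank 2 or 3 and a direct summand, so that its rank
   is the size of a [P]-orbit, hence 2; the stabiliser of that orbit is then the
   kernel of [W], which is trivial, and [#|P| = 2]. *)
Lemma coset_component_orthogonal (W : sV) :
    (1 < \rank (socle_base W))%N -> (\rank W < 4)%N -> ((W : 'M_h) <= Ap)%MS.
Proof.
set U := socle_base W => n_gt1 rW4.
have simU : mxsimple rV U := socle_simple W.
have [modU nzU minU] := simU.
(* [W] has no room for a second copy of [U]: two copies of rank at least 2 would span rank at least
   4. *)
have compU: (component_mx rV U <= U)%MS.
  have [I [W_ isoW defW]] := component_mx_def simU.
  rewrite defW; apply/sumsmx_subP=> i _; apply: contraTT rW4 => nsWU.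
  have simWi := mx_iso_simple (isoW i) simU; have [modWi _ minWi] := simWi.
  have dx: (U :&: W_ i = 0)%MS.
    apply/eqP; apply: contraNT nsWU => nz; apply: submx_trans (capmxSl _ (W_ i)).
    by apply: minWi nz; rewrite ?capmx_module ?capmxSr.
  have: (\rank (U + W_ i)%MS <= \rank W)%N.
    rewrite mxrankS // addsmx_sub; apply/andP.
    by split; [apply: component_mx_id | apply: mx_iso_component].
  rewrite mxrank_disjoint_sum // -(mxrank_iso (isoW i)); lia.
have defW: (W :=: U)%MS by apply/eqmxP; rewrite compU component_mx_id.
rewrite defW; apply/sub_kermxP/eqP/negPn/negP=> nzUS.
have [S simS nzS]: exists2 S, mxsimple rV S & U *m S^T != 0.
  have [I S_ /= simS defS _] := Socle_semisimple sV.
  have [i nzi | all0] := pickP (fun i => U *m (S_ i)^T != 0); first by exists (S_ i).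
  case/negP: nzUS; have: (Socle sV <= kermx U^T)%MS.
    rewrite -defS; apply/sumsmx_subP=> i _; apply/sub_kermxP/trmx_inj.
    by rewrite trmx_mul trmxK trmx0; apply/eqP/negbFE/all0.
  by move/sub_kermxP=> SU0; rewrite -[_ *m _]trmxK trmx_mul trmxK SU0 trmx0.
have [Pi [cPi sPi UPi]] := coset_projection simU simS nzS.
have [A [XA oA fixA]] := coset_summand_orbit char2 sylP simU compU cPi sPi UPi.
have r_dvd: (\rank U %| #|P|)%N by rewrite -oA dvdn_orbit.
have p_r: 2%N.-nat (\rank U) by apply: pnat_dvd r_dvd (pHall_pgroup sylP).
have r2: \rank U = 2%N.
  rewrite defW in rW4; case: (\rank U) n_gt1 rW4 p_r => [|[|[|[|r]]]] //.
case/eqP: oP; rewrite -(card_orbit_stab 'Rs P A) oA r2 -[RHS]muln1; congr (_ * _)%N.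
apply/eqP; rewrite -trivg_card1 -subG1; apply/subsetP=> g /setIP[Pg /astab1P cAg].
have Gg := subsetP (pHall_sub sylP) g Pg.
have: g \in rstab rV U.
  rewrite inE Gg; apply/eqP/fixA=> // B OB; rewrite /= rcosetE in cAg.
  have [-> // | neBA] := eqVneq B A.
  have OBg: (B :* g)%g \in orbit 'Rs P A.
    by rewrite -rcosetE -(orbit_eqP OB) mem_orbit.
  have sAB: [set A; B] \subset orbit 'Rs P A.
    by apply/subsetP=> C /set2P[]->; rewrite ?orbit_refl.
  have eqAB: [set A; B] = orbit 'Rs P A.
    by apply/eqP; rewrite eqEcard sAB oA r2 cards2 eq_sym neBA.
  move: OBg; rewrite -eqAB => /set2P[]// defBg; case/eqP: neBA.
  by rewrite -[B](rcosetK g) defBg -{1}cAg rcosetK.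
have [_ minG] := simpleP _ simG.
have [->|stabG] := minG _ (rstab_normal modU); first by [].
have: (U <= rfix_mx rV G)%MS.
  apply/rfix_mxP=> x Gx; have: x \in rstab rV U by rewrite stabG.
  by case/setIdP=> _ /eqP.
by move/mxrankS; rewrite r2 => /leq_trans/(_ rank_rfix).
Qed.

(** Sum the ranks of all components, counting twice those inside the orthogonal of the socle; the
    total is at most [h]. A component that is not a sum of trivial modules contributes at least 4,
    either by its rank or by being counted twice with rank at least 2. The one possible remaining
    component contributes at least 1, whence the 3. *)
Lemma coset_socle_bound : (4 * #|sV| <= h + 3)%N.
Proof.
have sumW: (\sum_(W : sV) \rank W + \sum_(W : sV | ((W : 'M_h) <= Ap)%MS) \rank W <= h)%N.
  rewrite -(mxdirectP (Socle_direct sV)) /= -(mxdirectP (subSocle_direct _)) /=.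
  apply: leq_trans (_ : \rank (Socle sV) + \rank Ap <= _)%N.
    by rewrite leq_add2l mxrankS //; apply/sumsmx_subP.
  by rewrite mxrank_ker mxrank_tr subnKC ?rank_leq_row.
rewrite [X in (_ + X <= _)%N]big_mkcond -big_split /= in sumW.
have card1: (#|[pred W : sV | \rank (socle_base W) == 1%N]| <= 1)%N.
  by apply/card_le1_eqP=> W1 W2 /eqP r1 /eqP r2; apply: coset_linear_uniq.
have: (\sum_(W : sV) 4 <= \sum_(W : sV) (3 * (\rank (socle_base W) == 1) +
   (\rank W + if ((W : 'M_h) <= Ap)%MS then \rank W else 0)))%N.
  apply: leq_sum => W _.
  have rW_gt0: (0 < \rank W)%N by rewrite lt0n mxrank_eq0 nz_socle.
  case: eqP => [_|/eqP n1] /=.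
    by rewrite addnA (leq_trans _ (leq_addr _ _)) // muln1 -[4]/(3 + 1)%N leq_add2l.
  rewrite muln0 add0n.
  have n_gt0: (0 < \rank (socle_base W))%N.
    by rewrite lt0n mxrank_eq0; case: (socle_simple W).
  have n_gt1: (1 < \rank (socle_base W))%N by lia.
  have [|rW4] := leqP 4 (\rank W); first by move/leq_trans->; rewrite ?leq_addr.
  rewrite coset_component_orthogonal //.
  have r2: (1 < \rank W)%N.
    by apply: leq_trans n_gt1 (mxrankS (component_mx_id _)); apply: socle_simple.
  exact: (leq_add r2 r2).
rewrite sum_nat_const big_split /= -big_distrr /= mulnC => le1.
apply: leq_trans le1 _; rewrite addnC leq_add //.
rewrite -[3%N]muln1 leq_mul2l /=; apply: leq_trans card1.
rewrite -[leqRHS]sum1_card [leqRHS]big_mkcond /=; apply: leq_sum => W _.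
by rewrite inE; case: eqP.
Qed.

End SocleBound.

End ModularRepresentations.

(** * Simple groups *)

Lemma simple_k2'_bound (gT : finGroupType) (G P : {group gT}) :
    2.-Sylow(G) P -> simple G -> ~~ abelian G -> #|P| != 2 ->
  4 * k2' G <= #|G|`_2^' + 3.
Proof.
move=> sylP simG nabG oP.
have [F [toF _]] := countable_algebraic_closure 'F_2.
have char2: 2 \in [pchar F]%R by apply: (GRing.rmorph_pchar toF); apply: pchar_Fp.
pose sV := DecSocleType (perm_repr F (actsRs_rcosets P G)).
have oX: #|rcosets P G| = (#|G|`_2^')%N.
  apply/eqP; rewrite -(eqn_pmul2l (cardG_gt0 P)) (Lagrange (pHall_sub sylP)).
  by rewrite (card_Hall sylP) partnC.
rewrite -oX; apply: leq_trans (coset_socle_bound char2 sylP simG nabG oP sV).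
rewrite leq_mul2l /=.
apply: (@k2'_le_irr _ _ _ _ (fun W x => \tr (socle_repr W x))%R char2) => n rG irrG.
by have [W trW] := irr_trace_coset_socle char2 sylP sV irrG; exists W.
Qed.

(** The transfer into [S] is a product over the cycles of [g] on cosets, of conjugates in [S] of
    powers of [g]; by assumption each equals that power, so the transfer of [g] is [g ^+ #|G : S|].
    It is trivial on the derived group, and the index is prime to [#|S|]. *)
Lemma transfer_fixed (gT : finGroupType) (G S : {group gT}) g :
    S \subset G -> abelian S -> coprime #|S| #|G : S| -> g \in S ->
    (forall n x, x \in G -> (g ^+ n) ^ x \in S -> (g ^+ n) ^ x = g ^+ n) ->
  g \in G^`(1) -> g = 1.
Proof.
move=> sSG cSS coSG Sg fix_g G'g.
have cAA: abelian (idm S @* S) by rewrite morphim_idm.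
pose tr := transfer_morphism G cAA.
have Gg := subsetP sSG g Sg.
have trg0: tr g = 1.
  have: tr g \in (tr @* G)^`(1) by rewrite -morphim_der // mem_morphim.
  by rewrite (derG1P (FinRing.zmod_abelian _)) => /set1P.
have trX := transversalP (rcosets_cycle_partition sSG Gg).
have Sg' : g \in idm S @* S by rewrite morphim_idm.
have trgE : tr g = FiniteModule.fmod cAA (g ^+ #|G : S|).
  rewrite /= (transfer_cycle_expansion sSG cAA Gg trX).
  rewrite -(sum_index_rcosets_cycle sSG Gg trX) FiniteModule.fmodX //.
  rewrite -GRing.sumrMnr; apply: eq_bigr => x Xx.
  have Gx: x \in G by apply: (subsetP (transversal_sub trX)).
  have Sgx: (g ^+ #|<[g]> : S :* x|) ^ x^-1 \in S.
    have := mulg_exp_card_rcosets S g x; case/rcosetP=> s Ss def_s.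
    by rewrite conjgE invgK mulgA def_s mulgK.
  rewrite fix_g ?groupV //= /restrm /= /idm.
  by rewrite FiniteModule.fmodX.
have: g ^+ #|G : S| = 1.
  have Sgn: g ^+ #|G : S| \in idm S @* S by rewrite morphim_idm ?groupX.
  by rewrite -(FiniteModule.fmodK cAA Sgn) -trgE trg0.
move/eqP; rewrite -order_dvdn => dvg; apply/eqP; rewrite -order_eq1 -dvdn1.
by rewrite -(eqP (coprime_dvdl (order_dvdG Sg) coSG)) dvdn_gcd dvdnn.
Qed.

(** Each fibre contains the two points [a] and [s a]. With [s] a conjugation and [f] the class map,
    this bounds numbers of classes. *)
Lemma card_imset_pair (T1 T2 : finType) (A : {set T1}) (f : T1 -> T2) (s : T1 -> T1) :
    {in A, forall a, [/\ s a \in A, s a != a & f (s a) = f a]} ->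
  2 * #|f @: A| <= #|A|.
Proof.
move=> sP; rewrite mulnC -sum_nat_const -[leqRHS]sum1_card (partition_big_imset f) /=.
apply: leq_sum => _ /imsetP[a Aa ->]; have [As ne_s fs] := sP a Aa.
rewrite (bigD1 a) ?Aa ?eqxx //= (bigD1 (s a)) ?As ?fs ?eqxx //=.
Qed.

(** * Fusion in abelian Sylow subgroups *)

Section AbelianSylow.
Variables (gT : finGroupType) (p : nat) (G S : {group gT}).
Hypotheses (sylS : p.-Sylow(G) S) (cSS : abelian S).

(** [S] and [S :^ x] are both Sylow subgroups of the centraliser of [a ^ x]; multiplying [x] by an
    element conjugating the second to the first there gives [y]. *)
Lemma abelian_Sylow_fusion a x : a \in S -> x \in G -> a ^ x \in S ->
  exists2 y, y \in 'N_G(S) & a ^ x = a ^ y.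
Proof.
move=> Sa Gx Sax; have sSG := pHall_sub sylS.
have Gax := subsetP sSG _ Sax.
have sCG: 'C_G[a ^ x] \subset G := subsetIl _ _.
have subC (R : {group gT}) : R \subset G -> abelian R -> a ^ x \in R -> R \subset 'C_G[a ^ x].
  by move=> sRG cRR Ra; rewrite subsetI sRG sub_cent1 (subsetP cRR).
have sylSC: p.-Sylow('C_G[a ^ x]) S by rewrite (pHall_subl _ sCG) ?subC.
have sylSxC: p.-Sylow('C_G[a ^ x]) (S :^ x).
  rewrite (pHall_subl _ sCG) ?pHallJ //; apply: subC; rewrite ?abelianJ ?memJ_conjg //.
  by rewrite conj_subG.
have [c /setIP[Gc /cent1P cac] defS] := Sylow_trans sylSxC sylSC.
exists (x * c); last by rewrite conjgM [RHS]conjgE -cac mulKg.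
by rewrite inE groupM //=; apply/normP; rewrite conjsgM -defS.
Qed.

Lemma abelian_Sylow_der1 a :
  'N_G(S) \subset 'C(S) -> a \in S -> a \in G^`(1) -> a = 1.
Proof.
move=> sNC Sa; have sSG := pHall_sub sylS.
apply: (transfer_fixed sSG cSS) => // [|n x Gx Sax].
  exact: pnat_coprime (pHall_pgroup sylS) (andP (andP sylS).2).2.
have [y Ny ->] := abelian_Sylow_fusion (groupX n Sa) Gx Sax.
by apply/conjg_fixP/commgP/commute_sym/(centP (subsetP sNC y Ny)); rewrite groupX.
Qed.

End AbelianSylow.

(** The automorphism group of a cyclic 2-group is a 2-group, while [P] centralises itself and so the
    index of the centraliser in the normaliser is odd. *)
Lemma cyclic_Sylow2_NC (gT : finGroupType) (G P : {group gT}) :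
  2.-Sylow(G) P -> cyclic P -> 'N_G(P) \subset 'C(P).
Proof.
move=> sylP cycP; have cPP := cyclic_abelian cycP; have sPG := pHall_sub sylP.
rewrite -indexg_eq1; apply/eqP.
have i_aut: #|'N_G(P) : 'C(P)| %| #|Aut P|.
  have <-: #|conj_aut P @* 'N_G(P)| = #|'N_G(P) : 'C(P)|.
    by rewrite card_morphim ker_conj_aut (setIidPr (subsetIr _ _)).
  by rewrite cardSg ?Aut_conj_aut.
rewrite card_Aut_cyclic // in i_aut.
have [n oP] := p_natP (pHall_pgroup sylP).
have: 2.-nat #|'N_G(P) : 'C(P)|.
  apply: pnat_dvd i_aut _; rewrite oP; case: n {oP} => [|n] //.
  by rewrite totient_pfactor // mul1n pnatX pnat_id.
move/pnat_1; apply; apply: pnat_dvd (_ : 2^'.-nat #|G : P|); last by case/and3P: sylP.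
have sPN: P \subset 'N_G(P) :&: 'C(P) by rewrite !subsetI sPG normG.
apply: dvdn_trans (_ : #|'N_G(P) : P| %| _).
  by rewrite -(Lagrange_index (subsetIl _ _) sPN) /= indexgI dvdn_mulr.
by rewrite -(@Lagrange_index _ G 'N_G(P) P) ?subsetIl ?subsetI ?sPG ?normG // dvdn_mull.
Qed.

Section SimpleGroup.
Variables (gT : finGroupType) (G : {group gT}).
Hypotheses (simG : simple G) (nabG : ~~ abelian G).

Lemma simple_perfect : G^`(1) = G.
Proof.
have [_ minG] := simpleP _ simG.
by have [/derG1P/(negP nabG) |] := minG _ (der_normal 1 G).
Qed.

Lemma simple_nonsolvable : ~~ solvable G.
Proof.
have [ntG _] := simpleP _ simG.
by apply/negP=> /forallP/(_ G); rewrite subsetI subxx -derg1 simple_perfect subxx /= (negPf ntG).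
Qed.

Lemma simple_Sylow_NC p (S : {group gT}) :
  p.-Sylow(G) S -> abelian S -> S :!=: 1 -> ~~ ('N_G(S) \subset 'C(S)).
Proof.
move=> sylS cSS; apply: contra => sNC; rewrite -subG1; apply/subsetP=> a Sa.
apply/set1P/(abelian_Sylow_der1 sylS cSS sNC Sa).
by rewrite simple_perfect (subsetP (pHall_sub sylS)).
Qed.

Lemma simple_Sylow2_noncyclic (P : {group gT}) :
  2.-Sylow(G) P -> P :!=: 1 -> ~~ cyclic P.
Proof.
move=> sylP ntP; apply/negP=> cycP.
by case/negP: (simple_Sylow_NC sylP (cyclic_abelian cycP) ntP); apply: cyclic_Sylow2_NC.
Qed.

Lemma simple_card_Sylow2 (P : {group gT}) : 2.-Sylow(G) P -> #|P| != 2.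
Proof.
move=> sylP; apply/eqP=> oP; have ntP: P :!=: 1 by rewrite trivg_card1 oP.
by have := simple_Sylow2_noncyclic sylP ntP; rewrite prime_cyclic ?oP.
Qed.

Lemma simple_k2'_le : 4 * k2' G <= #|G|`_2^' + 3.
Proof.
have [P sylP] := Sylow_exists 2 G.
exact: simple_k2'_bound sylP simG nabG (simple_card_Sylow2 sylP).
Qed.

(** Some element normalises [R] without centralising it. Any nontrivial element generates [R], so it
    is moved to a different element of its class. *)
Lemma card_prime_Sylow_classes p (R : {group gT}) :
    p.-Sylow(G) R -> #|R| = p -> prime p ->
  2 * #|[set x ^: G | x in R^#]| <= p.-1.
Proof.
move=> sylR oR pr_p; have cRR: abelian R.
  by rewrite cyclic_abelian // prime_cyclic ?oR.
have ntR: R :!=: 1 by rewrite trivg_card1 oR; case: p pr_p {sylR oR} => [|[]].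
have /subsetPn[n /setIP[Gn nRn] ncRn] := simple_Sylow_NC sylR cRR ntR.
have <-: #|R^#| = p.-1 by rewrite -oR (cardsD1 1 R) group1.
apply: (card_imset_pair (s := fun x => x ^ n)) => x /setD1P[nt_x Rx].
split; last by rewrite classGidl.
  by rewrite !inE conjg_eq1 nt_x memJ_norm.
apply: contra ncRn => /eqP/conjg_fixP/commgP cxn.
have defR: R :=: <[x]>.
  apply/eqP; rewrite eq_sym eqEcard cycle_subG Rx /=.
  have xp: x ^+ p = 1 by rewrite -oR expg_cardG.
  by rewrite -[#|<[x]>|]/#[x] (nt_prime_order pr_p xp nt_x) oR.
by rewrite defR cent_cycle; apply/cent1P.
Qed.

End SimpleGroup.

(** * Simple groups whose odd part involves two primes *)

Section TwoOddPrimes.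
Variables (gT : finGroupType) (G S R : {group gT}) (p q : nat).
Hypotheses (simG : simple G) (nabG : ~~ abelian G).
Hypotheses (sylS : p.-Sylow(G) S) (cSS : abelian S).
Hypotheses (sylR : q.-Sylow(G) R) (oR : #|R| = q) (pr_q : prime q).
Hypotheses (oG : (#|G|`_2^' = #|S| * #|R|)%N).

Let pi_SR r : prime r -> r %| (#|S| * #|R|)%N -> (r == p) || (r == q).
Proof.
move=> pr_r; rewrite Euclid_dvdM // => /orP[] dv_r.
  by apply/orP; left; apply: (pgroupP (pHall_pgroup sylS) r pr_r dv_r).
by apply/orP; right; apply: (pgroupP (pHall_pgroup sylR) r pr_r dv_r).
Qed.

(** If both parts of [x] were nontrivial, the p-part would be centralised by a conjugate of the
    abelian [S] and by an element of order divisible by [q]. Its class size would be a power of 2,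
    which Burnside's theorem forbids in a nonabelian simple group. *)
Lemma simple_odd_elt x : x \in G -> odd #[x] -> p.-elt x || q.-elt x.
Proof.
move=> Gx odd_x; have odvd: #[x] %| (#|S| * #|R|)%N.
  rewrite -oG -(@part_pnat_id 2^' #[x]) -?odd_2'nat //.
  exact: partn_dvd (cardG_gt0 G) (order_dvdG Gx).
have pi_x r : prime r -> r %| #[x] -> (r == p) || (r == q).
  by move=> pr_r /dvdn_trans/(_ odvd); apply: pi_SR.
apply/norP=> [[np nq]].
have nt_y: x.`_p != 1.
  apply: contra nq => /eqP/constt1P p'x; apply/pgroupP=> r pr_r dv_r.
  case/orP: (pi_x r pr_r dv_r) => // /eqP def_r.
  by have:= pgroupP p'x r pr_r dv_r; rewrite def_r !inE eqxx.
have nt_z: x.`_q != 1.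
  apply: contra np => /eqP/constt1P q'x; apply/pgroupP=> r pr_r dv_r.
  case/orP: (pi_x r pr_r dv_r) => // /eqP def_r.
  by have:= pgroupP q'x r pr_r dv_r; rewrite def_r !inE eqxx.
set y := x.`_p in nt_y; set z := x.`_q in nt_z.
have Gy: y \in G by rewrite groupX.
have Gz: z \in G by rewrite groupX.
have Cyz: z \in 'C_G[y].
  by rewrite inE Gz; apply/cent1P; apply: commuteX2.
have q_dvd: q %| #|'C_G[y]|.
  rewrite -[q](pdiv_p_elt (p_elt_constt q x) nt_z).
  exact: dvdn_trans (pdiv_dvd _) (order_dvdG Cyz).
have [g Gg sySg]: exists2 g, g \in G & <[y]> \subset S :^ g.
  by apply: Sylow_subJ sylS _ _; rewrite ?cycle_subG // [_.-group _]p_elt_constt.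
have sSgC: S :^ g \subset 'C_G[y].
  rewrite subsetI conj_subG ?(pHall_sub sylS) //= sub_cent1.
  apply: (subsetP (_ : S :^ g \subset _)); last by rewrite -cycle_subG.
  by rewrite -[_ \subset _]/(abelian _) abelianJ.
pose i := #|G : 'C_G[y]|.
have iG: (#|'C_G[y]| * i = #|G|)%N by rewrite Lagrange ?subsetIl.
have p'i: p^'.-nat i.
  apply: pnat_dvd (_ : p^'.-nat #|G : S :^ g|); last first.
    by have := sylS; rewrite -(pHallJ _ _ Gg) => /and3P[].
  by rewrite -(Lagrange_index _ sSgC) ?subsetIl ?dvdn_mulr.
have nq_i: ~~ (q %| i).
  apply/negP=> q_i; have: (q * q %| #|G|)%N by rewrite -iG dvdn_mul.
  move/(partn_dvd q (cardG_gt0 G)); rewrite part_pnat_id ?pnatM ?pnat_id //.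
  rewrite -(card_Hall sylR) oR.
  by rewrite -[X in _ %| X]muln1 dvdn_pmul2l ?prime_gt0 // dvdn1; case: eqP pr_q => // ->.
have p2_i: 2.-nat i.
  apply/pnatP=> [|r pr_r r_i]; first by rewrite indexg_gt0.
  apply/idPn=> /= ne_r2; have: r %| #|G|`_2^'.
    have rG: r %| #|G| by rewrite -iG dvdn_mull.
    have <-: (r`_2^' = r)%N by rewrite part_pnat_id // pnatE.
    exact: partn_dvd (cardG_gt0 G) rG.
  rewrite oG => /(pi_SR pr_r)/orP[] /eqP def_r; last by rewrite -def_r r_i in nq_i.
  by have := p'i; rewrite p'natE -?def_r // r_i.
have yG: y ^: G \in (classes G)^#.
  by rewrite !inE mem_classes // andbT classG_eq1.
have:= primes_class_simple_gt1 simG nabG yG; rewrite -index_cent1 -/i.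
rewrite ltnNge => /negP; apply; apply: (@uniq_leq_size _ _ [:: 2]); rewrite ?primes_uniq //.
by move=> r r_i; rewrite inE; apply: (pnatPpi p2_i r_i).
Qed.

Lemma simple_k2'_le_Sylow :
  k2' G <= #|[set x ^: G | x in S]| + #|[set x ^: G | x in R^#]|.
Proof.
apply: leq_trans (leq_card_setU _ _); apply/subset_leq_card/subsetP=> C.
have sylE r (T : {group gT}) x : r.-Sylow(G) T -> x \in G -> r.-elt x ->
  exists2 y, y \in T & x ^: G = y ^: G.
  move=> sylT Gx r_x; have [g Gg] : exists2 g, g \in G & <[x]> \subset T :^ g.
    by apply: Sylow_subJ sylT _ _; rewrite ?cycle_subG.
  rewrite cycle_subG mem_conjg => Txg; exists (x ^ g^-1) => //.
  by rewrite classGidl ?groupV.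
case/imsetP=> x /[!inE]/andP[Gx odd_x] ->{C}.
case/orP: (simple_odd_elt Gx odd_x) => r_x.
  have [y Sy ->] := sylE _ _ _ sylS Gx r_x.
  by apply/orP; left; apply/imsetP; exists y.
have [y Ry ->] := sylE _ _ _ sylR Gx r_x; apply/orP.
have [->|nt_y] := eqVneq y 1; first by left; apply/imsetP; exists 1.
by right; apply/imsetP; exists y; rewrite // !inE nt_y.
Qed.

End TwoOddPrimes.

Section SmallOddPart.
Variables (gT : finGroupType) (G : {group gT}).
Hypotheses (simG : simple G) (nabG : ~~ abelian G).

Local Notation hG := (#|G|`_2^')%N.

(** Otherwise the order has at most two prime divisors, and Burnside's theorem makes [G]
    solvable. *)
Lemma simple_odd_part_primes : 1 < size (primes hG).
Proof.
have: 2 < size (primes #|G|).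
  by rewrite ltnNge; apply: contra (simple_nonsolvable simG nabG); apply: Burnside_p_a_q_b.
rewrite primes_part size_filter -(count_predC [in 2^'] (primes #|G|)).
rewrite -[X in _ < _ + X -> _]/(count (predC [in 2^']) _).
have ->: count (predC [in 2^']) (primes #|G|) = count_mem 2 (primes #|G|).
  by apply: eq_count => r; rewrite !inE /= negbK.
by rewrite (count_uniq_mem _ (primes_uniq _)); case: (2 \in _) => /=; lia.
Qed.

Lemma simple_odd_part_cases : 4 * hG <= 15 * k2' G ->
  hG \in [:: 15; 21; 33; 45].
Proof.
have := simple_odd_part_primes; have := simple_k2'_le simG nabG.
have: odd hG by rewrite odd_2'nat part_pnat.
move: (hG) (k2' G) => h k odd_h le1 pr_h le2.
(* The two bounds give [16 h <= 60 k <= 15 h + 45], hence [h <= 45] and [k <= 12]; the rest is a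
   finite check. *)
have h45: h < 46 by lia.
have k13: k < 13 by lia.
have: all (fun h0 => all (fun k0 => [&& odd h0, 1 < size (primes h0), 4 * k0 <= h0 + 3
   & 4 * h0 <= 15 * k0] ==> (h0 \in [:: 15; 21; 33; 45])) (iota 0 13)) (iota 0 46).
  by vm_compute.
move/allP/(_ h); rewrite mem_iota h45 => /(_ isT)/allP/(_ k).
by rewrite mem_iota k13 odd_h pr_h le1 le2 => /(_ isT).
Qed.

Let sylow_card p (T : {group gT}) n : prime p -> p != 2 -> hG = n -> p.-Sylow(G) T -> #|T| = (n`_p)%N.
Proof.
move=> pr_p ne_p2 <- sylT.
by rewrite (card_Hall sylT); apply/esym/partn_part => r /eqnP->; rewrite !inE.
Qed.

(** There is one class for 1, at most one of elements of order 3, and at most [(q - 1) / 2] of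
    elements of order [q]. *)
Lemma simple_odd_part_3q q : prime q -> 3 < q -> hG = (3 * q)%N ->
  2 * k2' G <= q + 3.
Proof.
move=> pr_q q_gt3 oG.
have [S sylS] := Sylow_exists 3 G; have [R sylR] := Sylow_exists q G.
have ne_q2: q != 2 by apply: contraL q_gt3 => /eqP->.
have oS: #|S| = 3.
  rewrite (sylow_card _ _ oG sylS) // partnM ?prime_gt0 // part_pnat_id //.
  by rewrite part_p'nat ?muln1 // p'natE // dvdn_prime2 //; case: eqP q_gt3 => // <-.
have oR: #|R| = q.
  rewrite (sylow_card _ _ oG sylR) // partnM ?prime_gt0 // mulnC part_pnat_id ?pnat_id //.
  by rewrite part_p'nat ?muln1 // p'natE // dvdn_prime2 //; case: eqP q_gt3 => // ->.
have cSS: abelian S by rewrite cyclic_abelian // prime_cyclic ?oS.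
have oSR: (hG = #|S| * #|R|)%N by rewrite oS oR.
have le1 := simple_k2'_le_Sylow simG nabG sylS cSS sylR oR pr_q oSR.
have le2 := card_prime_Sylow_classes simG nabG sylS oS isT.
have le3 := card_prime_Sylow_classes simG nabG sylR oR pr_q.
have le4: #|[set x ^: G | x in S]| <= 1 + #|[set x ^: G | x in S^#]|.
  rewrite -(cards1 (1 ^: G)); apply: leq_trans (leq_card_setU _ _).
  apply/subset_leq_card/subsetP=> _ /imsetP[x Sx ->]; apply/setUP.
  have [->|nt_x] := eqVneq x 1; first by left; apply/set1P.
  by right; apply/imsetP; exists x; rewrite // !inE nt_x.
lia.
Qed.

(** The Sylow 3-subgroup, abelian of order 9, meets at most 9 classes; elements of order 5 form at
    most 2. *)
Lemma simple_odd_part_45 : hG = 45 -> k2' G <= 11.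
Proof.
move=> oG; have [S sylS] := Sylow_exists 3 G; have [R sylR] := Sylow_exists 5 G.
have oS: #|S| = 9.
  rewrite (sylow_card _ _ oG sylS) // -[45]/(9 * 5)%N partnM //.
  by rewrite (@part_pnat_id _ 9) // part_p'nat.
have oR: #|R| = 5.
  rewrite (sylow_card _ _ oG sylR) // -[45]/(9 * 5)%N partnM //.
  by rewrite (@part_pnat_id _ 5) // part_p'nat.
have cSS: abelian S by rewrite (@card_p2group_abelian _ 3) ?oS.
have oSR: (hG = #|S| * #|R|)%N by rewrite oS oR.
have le1 := simple_k2'_le_Sylow simG nabG sylS cSS sylR oR isT oSR.
have le3 := card_prime_Sylow_classes simG nabG sylR oR isT.
have le4: #|[set x ^: G | x in S]| <= 9 by rewrite -oS leq_imset_card.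
lia.
Qed.

End SmallOddPart.

Section CosetPerm.
Variables (gT : finGroupType) (G M : {group gT}).
Let X := rcosets M G.
Let XM : gval M \in X. Proof. by rewrite -{1}[gval M]rcoset1 -rcosetE imset_f. Qed.

(** Right multiplication on cosets, transported to ordinals so that index 5 leads to ['Alt_('I_5)].
    The identity outside [G] is a default that keeps the map injective. *)
Definition coset_perm_fun x (i : 'I_#|X|) : 'I_#|X| :=
  if x \in G then enum_rank_in XM (enum_val i :* x) else i.

Let XJ A x : A \in X -> x \in G -> A :* x \in X.
Proof. by move=> XA Gx; rewrite -rcosetE (acts_act (actsRs_rcosets M G)). Qed.

Let XK : {in X, cancel (enum_rank_in XM) enum_val}. Proof. exact: enum_rankK_in. Qed.

Fact coset_perm_inj x : injective (coset_perm_fun x).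
Proof.
move=> i j; rewrite /coset_perm_fun; case: ifP => // Gx /(congr1 enum_val).
have Xx (l : 'I_#|X|) : enum_val l :* x \in X by apply: XJ (enum_valP l) Gx.
by rewrite (XK (Xx i)) (XK (Xx j)) => /(can_inj (rcosetK x))/enum_val_inj.
Qed.

Definition coset_perm x := perm (@coset_perm_inj x).

Fact coset_permM : {in G &, {morph coset_perm : x y / x * y}}.
Proof.
move=> x y Gx Gy; apply/permP=> i; rewrite permM !permE /coset_perm_fun groupM // Gx Gy.
by rewrite (XK (XJ (enum_valP i) Gx)) rcosetM.
Qed.

Canonical coset_perm_morphism := Morphism coset_permM.

Lemma injm_coset_perm : simple G -> M \proper G -> 'injm coset_perm.
Proof.
move=> /simpleP[_ minG] ltMG; have [-> // | kerG] := minG _ (ker_normal coset_perm_morphism).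
case/andP: ltMG => sMG /negP[]; apply/subsetP=> x Gx.
have kx: x \in 'ker coset_perm by rewrite kerG.
have /permP/(_ (enum_rank_in XM M)) := mker kx.
rewrite permE perm1 /coset_perm_fun Gx => /(congr1 enum_val).
rewrite (XK XM) (XK (XJ XM Gx)) => Mx.
by rewrite -Mx rcoset_refl.
Qed.

End CosetPerm.

Lemma perfect_sub_Alt (T : finType) (H : {group {perm T}}) : H^`(1) = H -> H \subset 'Alt_T.
Proof.
move=> <-; rewrite gen_subG; apply/subsetP=> _ /imset2P[s t _ _ ->].
by rewrite Alt_even !odd_permM !odd_permV; case: (odd_perm s); case: (odd_perm t).
Qed.

Section A5.
Variables (gT : finGroupType) (G : {group gT}).
Hypotheses (simG : simple G) (nabG : ~~ abelian G).

Lemma simple_index5_Alt (M : {group gT}) :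
  M \subset G -> #|G : M| = 5 -> 60 <= #|G| -> G \isog 'Alt_('I_5).
Proof.
move=> sMG iM leG; have ltMG: M \proper G.
  by rewrite properEneq sMG andbT; apply: contra_eqN iM => /eqP->; rewrite indexgg.
have inj := injm_coset_perm simG ltMG.
have perfG := simple_perfect simG nabG.
have: G \isog coset_perm_morphism G M @* G by apply: sub_isog.
have sA: coset_perm_morphism G M @* G \subset 'Alt_('I_#|rcosets M G|).
  by apply: perfect_sub_Alt; rewrite -morphim_der // perfG.
have: #|coset_perm_morphism G M @* G| = #|G| by rewrite card_injm.
move: (coset_perm_morphism G M @* G) sA; rewrite -/(#|G : M|) iM => H sHA oH isoGH.
have oA: (2 * #|'Alt_('I_5)|)%N = 120 by rewrite card_Alt card_ord.
have <-: H = 'Alt_('I_5).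
  apply/eqP; rewrite eqEcard sHA oH /=.
  by rewrite -(leq_pmul2l (isT : 0 < 2)) oA -[120]/(2 * 60)%N leq_pmul2l.
by [].
Qed.

Local Notation hG := (#|G|`_2^')%N.

Lemma rcoset_stab (P : {group gT}) g : 'C_P[P :* g | 'Rs] = P :&: P :^ g.
Proof.
apply/setP=> x; rewrite !inE sub1set inE /= rcosetE -rcosetM mem_conjg.
congr (_ && _); apply/eqP/idP=> [eqP | Pxg].
  have: g * x \in P :* g by rewrite -eqP rcoset_refl.
  by rewrite mem_rcoset conjgE invgK mulgA.
by rewrite -[g * x](mulgKV g); rewrite conjgE invgK mulgA in Pxg; rewrite rcosetM rcoset_id.
Qed.

(** If [P] is self-normalising, it fixes only one of the 15 cosets, and some orbit on the other 14
    has length 2. The stabiliser [Q] of a point in it is nontrivial and of index 2 in [P] and in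
    another conjugate of [P], so both normalise it and its normaliser serves as [M]. *)
Lemma simple_odd_part_15_over (P : {group gT}) : hG = 15 -> 2.-Sylow(G) P -> 2 < #|P| ->
  exists M : {group gT}, [/\ P \proper M & M \proper G].
Proof.
move=> oG sylP P_gt2; have sPG := pHall_sub sylP; have [ntG minG] := simpleP _ simG.
have iP: #|G : P| = 15.
  apply/eqP; rewrite -(eqn_pmul2l (cardG_gt0 P)) Lagrange // -oG.
  by rewrite (card_Hall sylP) partnC.
have prPG: P \proper G.
  by rewrite properEneq sPG andbT; apply: contra_eqN iP => /eqP->; rewrite indexgg.
have nsubG (Q : {group gT}) : Q \subset P -> Q :!=: 1 -> 'N_G(Q) \proper G.
  move=> sQP ntQ; rewrite properEneq subsetIl andbT; apply: contraNneq ntQ => defN.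
  have nsQG: Q <| G by rewrite /normal (subset_trans sQP sPG) -defN subsetIr.
  have [-> // | defG] := minG _ nsQG.
  by case/andP: prPG => _ /negP[]; rewrite -defG.
have ntP: P :!=: 1 by rewrite -cardG_gt1; lia.
have [sNP | nsNP] := boolP ('N_G(P) \subset P); last first.
  exists 'N_G(P)%G; rewrite nsubG //; split=> //.
  by rewrite properE nsNP subsetI sPG normG.
pose X := rcosets P G.
have actsX: [acts P, on X | 'Rs] by apply: subset_trans sPG (actsRs_rcosets P G).
have XP: gval P \in X by rewrite -{1}[gval P]rcoset1 -rcosetE imset_f.
have defP g : g \in G -> P \subset P :^ g -> P :* g = P.
  move=> Gg sPPg; apply: rcoset_id; apply: (subsetP sNP); rewrite inE Gg /=.
  by apply/normP/esym/eqP; rewrite eqEcard sPPg cardJg /=.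
have fixP A : A \in X -> #|orbit 'Rs P A| = 1%N -> A = P.
  case/rcosetsP=> g Gg -> o1; apply: defP => //.
  have := card_orbit_stab 'Rs P (P :* g); rewrite o1 mul1n rcoset_stab => oPP.
  by apply/setIidPl/eqP; rewrite eqEcard subsetIl oPP /=.
have oP1: #|orbit 'Rs P P| = 1%N.
  rewrite (orbit1P _) ?cards1 //; apply/afixP=> x Px.
  by rewrite /= rcosetE rcoset_id.
have [A XA oA]: exists2 A, A \in X & #|orbit 'Rs P A| = 2.
  have [A /andP[XA /eqP oA] | no2] := pickP [pred A in X | #|orbit 'Rs P A| == 2].
    by exists A.
  have := acts_sum_card_orbit actsX; rewrite [#|X|]iP.
  rewrite (bigD1 (orbit 'Rs P P)) ?imset_f //= oP1 => sum14.
  (* Without an orbit of length 2, all orbits other than the fixed coset have length divisible by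
     4. *)
  suffices: 4 %| 14 by [].
  rewrite -[14]/(15 - 1)%N -sum14 addKn; apply: dvdn_sum => O /andP[/imsetP[A XA ->] neA].
  have /negbT := no2 A; rewrite /= XA /= => ne2.
  have ne1: #|orbit 'Rs P A| != 1%N.
    by apply: contraNneq neA => /(fixP A XA)->.
  have: 2.-nat #|orbit 'Rs P A|.
    by apply: pnat_dvd (pHall_pgroup sylP); apply: dvdn_orbit.
  case/p_natP=> [[|[|k]]] ok; rewrite ?ok // in ne1 ne2 *.
  by rewrite -[4]/(2 ^ 2)%N dvdn_exp2l.
have /rcosetsP[g Gg defA] := XA.
pose Q := (P :&: P :^ g)%G.
have oQ: (2 * #|Q|)%N = #|P| by rewrite /= -rcoset_stab -oA defA card_orbit_stab.
have sQP: Q \subset P := subsetIl _ _; have sQPg: Q \subset P :^ g := subsetIr _ _.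
have nQP: P \subset 'N(Q).
  by apply/normal_norm/index2_normal; rewrite // -divgS //= -oQ mulnK.
have nQPg: P :^ g \subset 'N(Q).
  by apply/normal_norm/index2_normal; rewrite // -divgS //= cardJg -oQ mulnK.
have ntQ: Q :!=: 1 by rewrite -cardG_gt1 -(ltn_pmul2l (isT : 0 < 2)) oQ.
exists 'N_G(Q)%G; rewrite nsubG //; split=> //.
rewrite properE subsetI sPG nQP /=; apply/negP=> sNQP.
have: P :^ g \subset P by apply: subset_trans sNQP; rewrite subsetI conj_subG.
move=> sPgP; have: P :* g = P.
  by apply: defP => //; rewrite -(geq_leqif (subset_leqif_card sPgP)) cardJg.
by rewrite -defA => A_P; rewrite A_P oP1 in oA.
Qed.

(** A subgroup strictly between [P] and [G] has index 3 or 5. Index 3 would embed a group of order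
    at least 60 in a group of order 6. *)
Lemma simple_odd_part_15 : hG = 15 -> G \isog 'Alt_('I_5).
Proof.
move=> oG; have [P sylP] := Sylow_exists 2 G; have sPG := pHall_sub sylP.
have oGP: (#|P| * 15)%N = #|G| by rewrite (card_Hall sylP) -oG partnC.
have P_gt3: 3 < #|P|.
  have := simple_card_Sylow2 simG nabG sylP.
  case/p_natP: (pHall_pgroup sylP) => [[|[|k]]] oP; rewrite oP // => _.
    case/negP: (simple_nonsolvable simG nabG); apply: Burnside_p_a_q_b.
    by rewrite -oGP oP.
  by rewrite (@leq_pexp2l 2 2 k.+2).
have [M [ltPM ltMG]] := simple_odd_part_15_over oG sylP (ltnW P_gt3).
have sMG := proper_sub ltMG; have sPM := proper_sub ltPM.
have iP: (#|G : M| * #|M : P|)%N = 15.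
  rewrite Lagrange_index //; apply/eqP; rewrite -(eqn_pmul2l (cardG_gt0 P)).
  by rewrite Lagrange // oGP.
have iM1: 1 < #|G : M| by rewrite indexg_gt1 proper_subn.
have iP1: 1 < #|M : P| by rewrite indexg_gt1 proper_subn.
have iM: #|G : M| = 3 \/ #|G : M| = 5.
  have: #|G : M| \in divisors 15 by rewrite -dvdn_divisors // -iP dvdn_mulr.
  rewrite -[divisors 15]/[:: 1; 3; 5; 15]%N !inE => /or4P[]/eqP iM; auto.
    by rewrite iM in iM1.
  by move: iP iP1; rewrite iM -{2}[15]muln1 => /eqP; rewrite eqn_pmul2l // => /eqP->.
have leG: 60 <= #|G| by rewrite -oGP (@leq_pmul2r 15 4).
case: iM => iM; last exact: simple_index5_Alt sMG iM leG.
have inj := injm_coset_perm simG ltMG.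
have: #|G| <= (#|rcosets M G|)`!.
  rewrite -(card_injm inj (subxx G)) -[X in X`!]card_ord -card_Sym.
  by rewrite subset_leq_card ?subsetT.
by rewrite [#|rcosets M G|]iM leqNgt (leq_trans _ leG).
Qed.

Theorem simple_d2'_le : 15 * k2' G <= 4 * hG /\
  (15 * k2' G = 4 * hG -> G \isog 'Alt_('I_5))%N.
Proof.
have [lt | ge] := ltnP (15 * k2' G) (4 * hG).
  by split=> [|eq]; [apply: ltnW | rewrite eq ltnn in lt].
have le1 := simple_k2'_le simG nabG.
have := simple_odd_part_cases simG nabG ge.
(* For odd parts 21, 33 and 45 there are at most 5, 7 and 11 classes, and 75, 105, 165 lie below 84,
   132, 180. *)
rewrite !inE => /or4P[]/eqP oG.
- by split=> [|_]; [lia | apply: simple_odd_part_15].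
- by have := @simple_odd_part_3q _ _ simG nabG 7 isT isT oG; lia.
- by have := @simple_odd_part_3q _ _ simG nabG 11 isT isT oG; lia.
by have := simple_odd_part_45 simG nabG oG; lia.
Qed.

End A5.

(** * Quotients and nonsolvable groups *)

Local Notation h G := (#|G|`_2^')%N.

Lemma k2'_sum_cent (gT : finGroupType) (G : {group gT}) :
  (k2' G * #|G|)%N = \sum_(x in G | odd #[x]) #|'C_G[x]|.
Proof.
pose A := [set x in G | odd #[x]].
rewrite (eq_bigl (fun x => x \in A)) => [|x]; last by rewrite inE.
rewrite (partition_big_imset (fun x => x ^: G)) /= -[k2' G]/#|[set x ^: G | x in A]|.
rewrite -sum_nat_const; apply: eq_bigr => _ /imsetP[x /setIdP[Gx odd_x] ->].
rewrite (eq_bigl (fun y => y \in x ^: G)) => [|y]; last first.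
  apply/andP/idP=> [[_ /eqP/class_eqP] // | /imsetP[z Gz ->]].
  by rewrite inE groupJ // orderJ odd_x classGidl.
rewrite (eq_bigr (fun=> #|'C_G[x]|)) => [|_ /imsetP[z Gz ->]].
  by rewrite sum_nat_const -index_cent1 mulnC Lagrange ?subsetIl.
by rewrite -(cardJg 'C_G[x] z) conjIg conjGid // cent1J.
Qed.

Lemma constt_mul_odd (gT : finGroupType) (x u : gT) :
    odd #[x] -> 2.-elt u -> commute x u ->
  (x * u).`_2 = u /\ (x * u).`_2^' = x.
Proof.
rewrite odd_2'nat => odd_x p_u cxu; rewrite !consttM //.
rewrite (constt_p_elt p_u) (constt_p_elt odd_x).
rewrite (constt1P (_ : 2^'.-elt x)) // mul1g; split=> //.
by rewrite (constt1P _) ?mulg1 // /p_elt pnatNK.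
Qed.

Section Fibre.
Variables (gT : finGroupType) (G N : {group gT}).
Hypothesis nsNG : N <| G.
Let sNG := normal_sub nsNG.
Let nNG := subsetP (normal_norm nsNG).

Let card_coset_cent (X : coset_of N) m :
  #|[set y in G | (coset N y == X) && (y \in 'C[m])]| <= #|'C_N[m]|.
Proof.
set A := [set y in G | _]; have [-> | [y0]] := set_0Vmem A; first by rewrite cards0.
rewrite inE => /and3P[Gy0 /eqP X0 cy0].
rewrite -(card_lcoset A y0^-1).
apply/subset_leq_card/subsetP=> z; rewrite mem_lcoset invgK inE => /and3P[Gz /eqP Xz cz].
have Gz1: z \in G by rewrite -(groupMl _ Gy0).
rewrite inE -(groupMl _ cy0) cz andbT; apply: coset_idr; first exact: nNG.
by move: Xz; rewrite morphM ?nNG //= X0 => /(canRL (mulKg _)); rewrite mulVg.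
Qed.

(* The map [(x, n) |-> (n_2', x n_2)] from commuting pairs with [x] odd to
   commuting pairs with first entry odd in [N] is injective. *)
Lemma fibre_cent_sum (X : coset_of N) :
  \sum_(x in G | (coset N x == X) && odd #[x]) #|'C_N[x]|
    <= \sum_(m in N | odd #[m]) #|'C_N[m]|.
Proof.
pose A := [set u : gT * gT | [&& u.1 \in G, coset N u.1 == X, odd #[u.1] & u.2 \in 'C_N[u.1]]].
pose B := [set u : gT * gT |
  ((u.1 \in N) && odd #[u.1]) && [&& u.2 \in G, coset N u.2 == X & u.2 \in 'C[u.1]]].
have ->: \sum_(x in G | (coset N x == X) && odd #[x]) #|'C_N[x]| = #|A|.
  rewrite -sum1_card (eq_bigl (fun u => [&& u.1 \in G, coset N u.1 == X & odd #[u.1]]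
                                         && (u.2 \in 'C_N[u.1]))); last first.
    by case=> x n; rewrite !inE /= -!andbA.
  rewrite -(pair_big_dep (fun x => [&& x \in G, coset N x == X & odd #[x]])
              (fun x y => y \in 'C_N[x]) (fun _ _ => 1%N)) /=.
  by apply: eq_bigr => x _; rewrite sum1_card.
apply: leq_trans (_ : #|B| <= _).
  pose f (u : gT * gT) := (u.2.`_2^', u.1 * u.2.`_2).
  have fE x n : commute n x -> commute x n.`_2.
    by move=> cnx; apply/commute_sym/commute_sym/commuteX/commute_sym.
  rewrite -(card_in_imset (_ : {in A &, injective f})).
    apply/subset_leq_card/subsetP=> _ /imsetP[[x n] Axn ->].
    move: Axn; rewrite inE /= => /and4P[Gx /eqP Xx odd_x /setIP[Nn /cent1P cnx]].
    have Nn2: n.`_2 \in N by rewrite groupX.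
    have odd_n: odd #[n.`_2^'] by rewrite odd_2'nat; apply: p_elt_constt.
    rewrite inE /= groupX // odd_n /= groupM ?(subsetP sNG n.`_2) //=.
    rewrite morphM ?nNG ?(subsetP sNG n.`_2) //= Xx (coset_id Nn2) mulg1 eqxx /=.
    apply/cent1P; apply: commute_sym; apply: commuteM; first exact/commute_sym/commuteX/commute_sym.
    exact: commuteX2.
  move=> [x n] [y m] /[1!inE] /= /and4P[_ _ odd_x /setIP[_ /cent1P cnx]].
  rewrite inE => /and4P[/= _ _ odd_y /setIP[_ /cent1P cmy]] [eq1 eq2].
  (* The second coordinate determines [x] and the 2-part of [n] as its odd part and its 2-part. *)
  have [ex1 ex2] := constt_mul_odd odd_x (p_elt_constt 2 n) (fE _ _ _ cnx).
  have [ey1 ey2] := constt_mul_odd odd_y (p_elt_constt 2 m) (fE _ _ _ cmy).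
  rewrite -[n](consttC 2) -[m](consttC 2) eq1; congr (_, _ * _).
    by rewrite -ex2 eq2 ey2.
  by rewrite -ex1 eq2 ey1.
rewrite -sum1_card (eq_bigl (fun u => ((u.1 \in N) && odd #[u.1]) &&
   [&& u.2 \in G, coset N u.2 == X & u.2 \in 'C[u.1]])) => [|u]; last by rewrite inE.
rewrite -(pair_big_dep (fun m => (m \in N) && odd #[m])
   (fun m y => [&& y \in G, coset N y == X & y \in 'C[m]]) (fun _ _ => 1%N)) /=.
apply: leq_sum => m _; apply: leq_trans (card_coset_cent X m).
by rewrite -sum1_card; apply: eq_leq; apply: eq_bigl => y; rewrite inE.
Qed.

Let cent_quo x : x \in G -> #|'C_G[x]| <= #|'C_N[x]| * #|'C_(G / N)[coset N x]|.
Proof.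
move=> Gx; rewrite -(LagrangeI 'C_G[x] N) leq_mul //.
  by rewrite subset_leq_card // setIC setIA (setIidPl sNG).
rewrite -card_quotient; last by apply: subset_trans (subsetIl _ _) (normal_norm nsNG).
rewrite subset_leq_card //; apply/subsetP=> _ /morphimP[y Ny /setIP[Gy /cent1P cyx] ->].
rewrite inE mem_quotient //; apply/cent1P.
by rewrite /commute -!morphM ?nNG // cyx.
Qed.

(** The terms are grouped by the image [X] of [x], and [fibre_cent_sum] bounds every fibre by the
    sum for [N] alone. *)
Let quo_sum : \sum_(x in G | odd #[x]) #|'C_N[x]| * #|'C_(G / N)[coset N x]|
   <= (k2' N * #|N|) * (k2' (G / N) * #|G / N|).
Proof.
rewrite (partition_big (coset N) (fun X => (X \in G / N) && odd #[X])) /=; last first.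
  move=> x /andP[Gx odd_x]; rewrite mem_quotient //=.
  by apply: dvdn_odd odd_x; rewrite morph_order ?nNG.
rewrite [(k2' (G / N) * _)%N]k2'_sum_cent big_distrr /=; apply: leq_sum => X _.
rewrite (eq_bigr (fun x => #|'C_N[x]| * #|'C_(G / N)[X]|)%N) => [|x /andP[_ /eqP->] //].
rewrite -big_distrl leq_mul //= k2'_sum_cent; apply: leq_trans (fibre_cent_sum X).
by apply: eq_leq; apply: eq_bigl => x; rewrite -andbA [odd _ && _]andbC.
Qed.

Lemma k2'_quo_le : k2' G <= k2' N * k2' (G / N).
Proof.
rewrite -(leq_pmul2r (cardG_gt0 G)) {1}k2'_sum_cent.
apply: leq_trans (_ : \sum_(x in G | odd #[x]) #|'C_N[x]| * #|'C_(G / N)[coset N x]| <= _).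
  by apply: leq_sum => x /andP[Gx _]; apply: cent_quo.
apply: leq_trans quo_sum _; rewrite card_quotient ?normal_norm // -(Lagrange sNG).
by rewrite mulnACA.
Qed.

(** Equality makes every term of the centraliser estimate sharp. For [x] in [N] the image in the
    quotient is trivial, so [#|'C_G[x]|] is [#|'C_N[x]| * #|G / N|] and the two classes have the
    same size. *)
Lemma k2'_quo_eq x :
  k2' G = (k2' N * k2' (G / N))%N -> x \in N -> odd #[x] -> x ^: G = x ^: N.
Proof.
move=> eqk Nx odd_x; have Gx := subsetP sNG x Nx.
have := quo_sum; rewrite mulnACA -eqk card_quotient ?normal_norm //.
rewrite Lagrange // k2'_sum_cent.
rewrite (bigD1 x) ?Gx //= [leqRHS](bigD1 x) ?Gx //= => le_sum.
have le_x: #|'C_N[x]| * #|G / N| <= #|'C_G[x]|.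
  move: le_sum; rewrite (coset_id Nx) (_ : 'C_(G / N)[1] = G / N); last first.
    by apply/setIidPl/subsetP=> y _; rewrite cent11T inE.
  set r1 := (X in _ <= _ + X) => le_sum; rewrite -(leq_add2r r1).
  apply: leq_trans le_sum; rewrite leq_add2l /r1.
  by apply: leq_sum => y /andP[/andP[Gy _] _]; apply: cent_quo.
apply/esym/eqP; rewrite eqEcard; apply/andP; split.
  by apply/subsetP=> _ /imsetP[y Ny ->]; rewrite imset_f ?(subsetP sNG).
rewrite -(leq_pmul2r (cardG_gt0 'C_G[x])); apply: leq_trans (_ : #|G| <= _).
  by rewrite -index_cent1 mulnC Lagrange ?subsetIl.
apply: leq_trans (leq_mul (leqnn _) le_x).
by rewrite -index_cent1 mulnA [(_ * #|'C_N[x]|)%N]mulnC Lagrange ?subsetIl // card_quotient ?normal_norm // Lagrange.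
Qed.
End Fibre.

Lemma isog_k2' (gT rT : finGroupType) (G : {group gT}) (H : {group rT}) :
  G \isog H -> k2' G = k2' H.
Proof.
move=> isoGH; have [f injf defH] := isogP isoGH.
apply/eqP; rewrite -(eqn_pmul2r (cardG_gt0 G)) {2}(card_isog isoGH) !k2'_sum_cent.
rewrite -defH [X in _ == X]big_mkcondr morphimEdom big_imset /=; last exact/injmP.
rewrite big_mkcondr; apply/eqP/eq_bigr => x Gx.
rewrite -morphimEdom order_injm //; case: ifP => // _.
by rewrite -injm_subcent1 // card_injm ?subsetIl.
Qed.

Lemma odd_part_quo (gT : finGroupType) (G N : {group gT}) :
  N <| G -> h G = (h N * h (G / N))%N.
Proof.
move=> nsNG; rewrite card_quotient ?normal_norm // -partnM ?cardG_gt0 //.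
by rewrite Lagrange ?normal_sub.
Qed.

Lemma k2'_gt0 (gT : finGroupType) (G : {group gT}) : 0 < k2' G.
Proof.
apply/card_gt0P; exists (1 ^: G); apply/imsetP; exists 1 => //.
by rewrite inE group1 order1.
Qed.

Lemma k2'_le_card (gT : finGroupType) (G : {group gT}) :
  k2' G <= #|[set x in G | odd #[x]]|.
Proof. exact: leq_imset_card. Qed.

Lemma simple_k2'_le_odd_part (gT : finGroupType) (G : {group gT}) :
  simple G -> k2' G <= h G.
Proof.
move=> simG; have [abG | nabG] := boolP (abelian G); last first.
  by have [] := simple_d2'_le simG nabG; lia.
have pr_G := simple_sol_prime (abelian_sol abG) simG.
apply: leq_trans (k2'_le_card G) _; have [oG2 | neG2] := eqVneq #|G| 2.
  apply: leq_trans (part_gt0 _ _); rewrite -(cards1 (1 : gT)) subset_leq_card //.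
  apply/subsetP=> x /setIdP[Gx]; rewrite inE -order_eq1.
  by have:= order_dvdG Gx; rewrite oG2 (dvdn_divisors _ (isT : 0 < 2)) !inE => /orP[]/eqP->.
have odd_G: odd #|G| by apply: contraNT neG2 => /(prime_oddPn pr_G)->.
rewrite part_pnat_id -?odd_2'nat // subset_leq_card //.
by apply/subsetP=> x /setIdP[].
Qed.

Lemma k2'_le_odd_part (gT : finGroupType) (G : {group gT}) : k2' G <= h G.
Proof.
have [m] := ubnP #|G|; elim: m gT G => // m IHm gT G; rewrite ltnS => leGm.
have [G1 | ntG] := eqsVneq G 1.
  apply: leq_trans (k2'_le_card G) _; apply: leq_trans (part_gt0 _ _).
  rewrite -(cards1 (1 : gT)) subset_leq_card //.
  by apply/subsetP=> x; rewrite !inE G1 => /andP[/set1P-> _].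
have [N maxN] := ex_maxnormal_ntrivg ntG; have nsNG := maxnormal_normal maxN.
have ltNG := maxnormal_proper maxN; have simQ: simple (G / N) by rewrite quotient_simple.
apply: leq_trans (k2'_quo_le nsNG) _; rewrite (odd_part_quo nsNG) leq_mul //.
  by apply: IHm; apply: leq_trans (proper_card ltNG) leGm.
exact: simple_k2'_le_odd_part.
Qed.

(** Induction along a maximal normal subgroup [N]: either the simple quotient is nonabelian and
    supplies the factor 4/15, or [N] is nonsolvable and supplies it by induction. *)
Theorem nonsolvable_d2'_le (gT : finGroupType) (G : {group gT}) :
  ~~ solvable G -> 15 * k2' G <= 4 * h G.
Proof.
have [m] := ubnP #|G|; elim: m gT G => // m IHm gT G; rewrite ltnS => leGm nsolG.
have [G1 | ntG] := eqsVneq G 1; first by rewrite G1 solvable1 in nsolG.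
have [N maxN] := ex_maxnormal_ntrivg ntG; have nsNG := maxnormal_normal maxN.
have ltNG := maxnormal_proper maxN; have simQ: simple (G / N) by rewrite quotient_simple.
apply: leq_trans (_ : 15 * (k2' N * k2' (G / N)) <= _).
  by rewrite leq_mul2l k2'_quo_le.
rewrite (odd_part_quo nsNG); have [abQ | nabQ] := boolP (abelian (G / N)).
  rewrite !mulnA leq_mul ?k2'_le_odd_part //; apply: IHm.
    by apply: leq_trans (proper_card ltNG) leGm.
  by apply: contra nsolG => solN; rewrite (series_sol nsNG) solN abelian_sol.
by rewrite mulnCA [leqRHS]mulnCA leq_mul ?k2'_le_odd_part //; have [] := simple_d2'_le simQ nabQ.
Qed.

(** An odd class of the quotient is the image of the class of the odd part of any preimage. *)
Lemma k2'_quo_ge (gT : finGroupType) (G N : {group gT}) : N <| G -> k2' (G / N) <= k2' G.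
Proof.
move=> nsNG; have nNG := subsetP (normal_norm nsNG).
apply: leq_trans (leq_imset_card (fun C : {set gT} => C / N) _).
apply/subset_leq_card/subsetP=> _ /imsetP[X /setIdP[/morphimP[x Nx Gx ->] odd_x] ->].
have Gx': x.`_2^' \in G by rewrite groupX.
apply/imsetP; exists (x.`_2^' ^: G).
  apply/imsetP; exists x.`_2^' => //; rewrite inE Gx' odd_2'nat.
  exact: p_elt_constt.
rewrite /= quotient_class ?nNG //; last by apply/subsetP.
congr (_ ^: _); have /= -> := morph_constt (coset_morphism N) 2^' Nx.
by rewrite constt_p_elt // /p_elt -odd_2'nat.
Qed.

Lemma k2'_quo_2group (gT : finGroupType) (G N : {group gT}) :
  N <| G -> 2.-group N -> k2' (G / N) = k2' G.
Proof.
move=> nsNG pN; apply/eqP; rewrite eqn_leq k2'_quo_ge //=.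
apply: leq_trans (k2'_quo_le nsNG) _; rewrite -[leqRHS]mul1n leq_mul2r.
apply/orP; right; apply: leq_trans (k2'_le_odd_part N) _.
by rewrite part_p'nat // pnatNK.
Qed.

(** * The case of equality *)

(** Equality in a product of bounds forces equality in each; [m] and [n] are 15 and 4, or both 1. *)
Lemma tight_product m n a b c A B :
    0 < m -> 0 < a -> 0 < A -> 0 < B -> c <= a * b -> m * a <= n * A -> b <= B ->
  (m * c = n * (A * B) -> [/\ m * a = n * A, b = B & c = a * b])%N.
Proof.
move=> m0 a0 A0 B0 le1 le2 le3 eq.
have n0: 0 < n by rewrite lt0n; apply: contraTneq le2 => ->; rewrite mul0n -ltnNge muln_gt0 m0.
have eqc: c = (a * b)%N by apply/eqP; rewrite eqn_leq le1 -(leq_pmul2l m0) eq mulnA [leqRHS]mulnA leq_mul.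
have eqb: b = B.
  apply/eqP; rewrite eqn_leq le3 -(@leq_pmul2l (n * A)) ?muln_gt0 ?n0 // -mulnA -eq eqc.
  by rewrite mulnA leq_mul2r le2 orbT.
split=> //; apply/eqP; rewrite -(eqn_pmul2r B0) -mulnA -[(n * A * B)%N]mulnA -eq eqc eqb.
by [].
Qed.

Section Tight.
Variables (gT : finGroupType) (G N : {group gT}).
Hypotheses (nsNG : N <| G) (tightG : (15 * k2' G = 4 * h G)%N).

Lemma tight_normal_nonsolvable : ~~ solvable N ->
  [/\ (15 * k2' N = 4 * h N)%N, k2' (G / N) = h (G / N)
    & k2' G = (k2' N * k2' (G / N))%N].
Proof.
move=> nsolN; apply: tight_product; rewrite ?part_gt0 ?k2'_gt0 ?k2'_quo_le //.
- exact: nonsolvable_d2'_le.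
- exact: k2'_le_odd_part.
by rewrite -odd_part_quo.
Qed.

Lemma tight_quotient_nonsolvable : ~~ solvable (G / N) ->
  [/\ (15 * k2' (G / N) = 4 * h (G / N))%N, k2' N = h N
    & k2' G = (k2' N * k2' (G / N))%N].
Proof.
move=> nsolQ; rewrite [(k2' N * _)%N]mulnC.
apply: tight_product; rewrite ?part_gt0 ?k2'_gt0 //.
- by rewrite mulnC k2'_quo_le.
- exact: nonsolvable_d2'_le.
- exact: k2'_le_odd_part.
by rewrite [(h _ * h _)%N]mulnC -odd_part_quo.
Qed.

End Tight.

Lemma k2'_max_split (gT : finGroupType) (G N : {group gT}) :
    N <| G -> k2' G = h G ->
  k2' N = h N /\ k2' G = (k2' N * k2' (G / N))%N.
Proof.
move=> nsNG maxG; have [] := @tight_product 1 1 (k2' N) (k2' (G / N)) (k2' G) (h N) (h (G / N)).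
all: rewrite ?mul1n ?part_gt0 ?k2'_gt0 ?k2'_quo_le ?k2'_le_odd_part //.
by rewrite -odd_part_quo.
Qed.

Lemma k2'_max_odd_abelian (gT : finGroupType) (F : {group gT}) :
  odd #|F| -> k2' F = #|F| -> abelian F.
Proof.
move=> odd_F maxF; pose A := [set x in F | odd #[x]].
have defA: A = F.
  by apply/setP=> x; rewrite inE andb_idr // => Fx; apply: dvdn_odd (order_dvdG Fx) odd_F.
have inj: {in F &, injective (fun x => x ^: F)}.
  by apply/imset_injP; rewrite -[X in _ == X]maxF /k2' -/A defA.
apply/centsP=> x Fx y Fy; apply/commgP/conjg_fixP; apply: inj => //.
  by rewrite groupJ.
by rewrite classGidl.
Qed.

(** The preimage [K] of the Fitting subgroup of the quotient is a central extension of a nilpotent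
    group, hence nilpotent and inside ['F(G)]. So the solvable quotient has trivial Fitting subgroup
    and is trivial. *)
Lemma central_Fitting_solvable (gT : finGroupType) (G : {group gT}) :
  solvable G -> 'F(G) \subset 'Z(G) -> G :=: 'F(G).
Proof.
move=> solG sFZ; have nsFG := Fitting_normal G.
apply/eqP; rewrite eqEsubset Fitting_sub andbT -quotient_sub1 ?normal_norm // subG1.
have [K defK sFK nsKG] := inv_quotientN nsFG (Fitting_normal (G / 'F(G))).
have nFK: K \subset 'N('F(G)) := subset_trans (normal_sub nsKG) (normal_norm nsFG).
suffices nilK: nilpotent K.
  have solQ: solvable (G / 'F(G)) by apply: quotient_sol.
  rewrite -(trivg_Fitting solQ) defK -subG1 quotient_sub1 //.
  exact: Fitting_max nsKG nilK.
have sFZK: 'F(G) \subset 'Z(K).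
  rewrite subsetI sFK (subset_trans sFZ) // (subset_trans (subsetIr _ _)) //.
  by rewrite centS ?normal_sub.
rewrite -quotient_center_nil.
have nsFK: 'F(G) <| K by apply/andP; split.
rewrite -(isog_nil (third_isog sFZK nsFK (center_normal K))).
have:= Fitting_nil (G / 'F(G)); rewrite defK => nilKF.
exact: quotient_nil.
Qed.

(** The Fitting subgroup is odd and inherits the equality, so it is abelian; equality also keeps its
    classes from growing in [N], so it is central and equals [N]. *)
Lemma k2'_max_solvable (gT : finGroupType) (N : {group gT}) :
  solvable N -> 'O_2(N) = 1 -> k2' N = h N -> abelian N && odd #|N|.
Proof.
move=> solN O2N maxN; have nsFN := Fitting_normal N.
have [maxF eqF] := k2'_max_split nsFN maxN.
have odd_F: odd #|'F(N)|.
  rewrite odd_2'nat; have := nilpotent_pcore_Hall 2 (Fitting_nil N).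
  by rewrite p_core_Fitting O2N => /card_Hall; rewrite cards1 => /esym/eqP; rewrite partn_eq1.
rewrite part_pnat_id -?odd_2'nat // in maxF.
have abF := k2'_max_odd_abelian odd_F maxF.
suffices ->: N :=: 'F(N) by rewrite abF.
apply: central_Fitting_solvable => //; rewrite subsetI Fitting_sub; apply/centsP=> x Fx y Ny.
have odd_x: odd #[x] by apply: dvdn_odd (order_dvdG Fx) odd_F.
apply/commgP/conjg_fixP; have: x ^ y \in x ^: N by rewrite imset_f.
rewrite (k2'_quo_eq nsFN eqF Fx odd_x) => /imsetP[z Fz ->].
by apply/conjg_fixP/commgP/(centsP abF).
Qed.

Lemma card_Alt5 : #|'Alt_('I_5)| = 60.
Proof.
have: (2 * #|'Alt_('I_5)|)%N = (2 * 60)%N by rewrite card_Alt card_ord.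
by move/eqP; rewrite eqn_pmul2l // => /eqP.
Qed.

Lemma isog_Alt5 (gT : finGroupType) (M : {group gT}) :
  M \isog 'Alt_('I_5) -> [/\ simple M, ~~ abelian M & #|M| = 60].
Proof.
move=> isoM; rewrite (isog_simple isoM) simple_Alt5 ?card_ord //.
rewrite (card_isog isoM) card_Alt5; split=> //.
apply/negP=> /abelian_sol; rewrite (isog_sol isoM) solvable_AltF ?card_ord //.
Qed.

(** * Rigidity of [A_5] through its six Sylow 5-subgroups *)

Section Rigidity.
Variables (gT : finGroupType) (X M : {group gT}).
Hypotheses (nsMX : M <| X) (isoM : M \isog 'Alt_('I_5)) (cMX : 'C_X(M) = 1).
Hypothesis fus : {in M, forall x, odd #[x] -> x ^: X = x ^: M}.

Let simM : simple M. Proof. by case: (isog_Alt5 isoM). Qed.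
Let nabM : ~~ abelian M. Proof. by case: (isog_Alt5 isoM). Qed.
Let oM : #|M| = 60. Proof. by case: (isog_Alt5 isoM). Qed.
Let minM : forall H : {group gT}, H <| M -> H :=: 1 \/ H :=: M.
Proof. by case/simpleP: simM. Qed.

Let syl_card (R : {group gT}) : R \in 'Syl_5(M) -> #|R| = 5.
Proof.
rewrite inE => /card_Hall->; rewrite oM -[60]/(12 * 5)%N partnM //.
by rewrite part_p'nat // part_pnat_id.
Qed.

Let syl_nnorm (R : {group gT}) : R \in 'Syl_5(M) -> ~~ (M \subset 'N(R)).
Proof.
move=> sylR; have oR := syl_card sylR; apply/negP=> nRM.
have nsRM: R <| M.
  by apply/andP; split=> //; move: sylR; rewrite inE => /pHall_sub.
by have [R1|RM] := minM nsRM; [rewrite R1 cards1 in oR | rewrite RM oM in oR].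
Qed.

Let syl_ncard : #|'Syl_5(M)| = 6.
Proof.
have: #|'Syl_5(M)| \in divisors 60 by rewrite -dvdn_divisors // -oM card_Syl_dvd.
have:= card_Syl_mod M (isT : prime 5).
have: #|'Syl_5(M)| != 1%N.
  have [R sylR] := Sylow_exists 5 M; rewrite (card_Syl sylR) indexg_eq1.
  by rewrite subsetI subxx syl_nnorm // inE.
move: #|_| => n n1 n5.
have: all (fun n0 => [&& n0 != 1, n0 %% 5 == 1 & n0 != 6] ==> (n0 \notin divisors 60))%N (iota 0 61).
  by vm_compute.
move=> /allP/(_ n) check n_div; apply/eqP; apply: contraTT n_div => n6.
have [n61 | n_big] := ltnP n 61; last first.
  by rewrite -dvdn_divisors //; apply/negP=> /(dvdn_leq (isT : 0 < 60)); rewrite leqNgt n_big.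
by move: check; rewrite mem_iota n61 n1 n5 n6 => /(_ isT).
Qed.

(** The kernel [D] of the action on Sylow 5-subgroups meets the simple group [M] trivially. Both are
    normal in [X], so they commute, and ['C_X(M)] is 1. *)
Let faithful y : y \in X -> {in 'Syl_5(M), forall R : {group gT}, y \in 'N(R)} -> y = 1.
Proof.
move=> Xy nRy; have [sMX nMX] := andP nsMX.
have actsX: X \subset 'N('Syl_5(M) | 'JG).
  apply/actsP=> x Xx R /=; rewrite !inE.
  by rewrite -{1}(normP (subsetP nMX x Xx)) pHallJ2.
pose D := 'C_X('Syl_5(M) | 'JG)%G.
have nDX: X \subset 'N(D).
  rewrite normsI ?normG //; exact: subset_trans actsX (astab_norm _ _).
have DP d R : d \in D -> R \in 'Syl_5(M) -> d \in 'N(R).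
  case/setIP=> _ /astabP cd sylR; apply/normP.
  by have := congr1 val (cd R sylR).
have Dy: y \in D.
  rewrite inE Xy; apply/astabP=> R sylR; apply/val_inj/normP; exact: nRy.
have TI: D :&: M = 1.
  have nsDM: (D :&: M)%G <| M.
    by rewrite /normal subsetIr normsI ?normG // (subset_trans sMX).
  have [// | defM] := minM nsDM.
  have [R sylR] := Sylow_exists 5 M; have sylR' : R \in 'Syl_5(M) by rewrite inE.
  case/negP: (syl_nnorm sylR'); apply/subsetP=> m; rewrite -defM => /setIP[Dm _].
  exact: DP.
suffices: y \in 'C_X(M) by rewrite cMX => /set1P.
rewrite inE Xy; apply/centP=> m Mm; apply/commgP.
rewrite -in_set1 -[[set 1]]TI inE; apply/andP; split.
  by rewrite commgEl groupM ?groupV // memJ_norm // (subsetP nDX) // (subsetP sMX).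
by rewrite commgEr groupM // memJ_norm ?groupV // (subsetP nMX).
Qed.

(** By [fus], any [x] in [X] can be corrected by an element of [M] to some [y] centralising [c] of
    order 5. Then [y] fixes [R] and, commuting with [c], acts on the other five Sylow subgroups as
    some [a] in [<[c]>]; faithfulness gives [y = a]. *)
Lemma Alt5_rigid : X :=: M.
Proof.
have [sMX nMX] := andP nsMX.
apply/eqP; rewrite eqEsubset sMX andbT; apply/subsetP=> x Xx.
have [R sylR] := Sylow_exists 5 M; have sylR' : R \in 'Syl_5(M) by rewrite inE.
have oR := syl_card sylR'; have sRM := pHall_sub sylR.
have cycR: cyclic R by rewrite prime_cyclic ?oR.
have [c defR] := cyclicP cycR.
have Rc: c \in R by rewrite defR cycle_id.
have Mc := subsetP sRM c Rc.
have oc: #[c] = 5 by rewrite orderE -defR.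
have: c ^ x \in c ^: X by rewrite imset_f.
rewrite fus ?oc // => /imsetP[m Mm cxm].
suffices: x * m^-1 \in M by rewrite groupMr ?groupV.
have: x * m^-1 \in X by rewrite groupM ?groupV // (subsetP sMX).
have: commute (x * m^-1) c.
  by apply/commute_sym/commgP/conjg_fixP; rewrite conjgM cxm conjgK.
move: (x * m^-1) => y cyc Xy.
have nRy: R :^ y = R.
  by apply/normP; rewrite defR; apply: (subsetP (cent_sub _)); rewrite cent_cycle; apply/cent1P.
have nR_R1 (R1 : {group gT}) : R1 \in 'Syl_5(M) -> c \in 'N(R1) -> R1 :=: R.
  move=> sylR1 nR1c; have oR1 := syl_card sylR1.
  rewrite inE in sylR1.
  apply/eqP; rewrite eq_sym eqEcard oR oR1 leqnn andbT.
  have sRN: R \subset 'N_M(R1) by rewrite subsetI sRM defR cycle_subG.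
  have sylN: 5.-Sylow('N_M(R1)) R1 by rewrite Sylow_subnorm.
  have nsR1: R1 <| 'N_M(R1) by rewrite normalSG ?(pHall_sub sylR1).
  by rewrite (sub_normal_Hall sylN nsR1) // (pHall_pgroup sylR).
have actsM: [acts M, on 'Syl_5(M) | 'JG].
  exact: atrans_acts (Syl_trans 5 M).
have sCM: <[c]> \subset M by rewrite cycle_subG.
have oD: #|'Syl_5(M) :\ R| = 5.
  by have := cardsD1 R 'Syl_5(M); rewrite syl_ncard sylR' add1n => -[<-].
have [R1 /setD1P[neR1 sylR1]]: exists R1, R1 \in 'Syl_5(M) :\ R.
  by apply/set0Pn; rewrite -card_gt0 oD.
have fixR a : a \in <[c]> -> R :^ a = R.
  by move=> ca; apply/normP/(subsetP (normG R)); rewrite defR.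
(* [c] normalises no Sylow 5-subgroup except [R], so its orbit length here is 5. *)
have orbR1: orbit 'JG <[c]> R1 = 'Syl_5(M) :\ R.
  apply/eqP; rewrite eqEcard oD; apply/andP; split.
    apply/subsetP=> _ /orbitP[a ca <-]; rewrite !inE /=; apply/andP; split.
      apply: contraNneq neR1 => /(congr1 val) /= defR1; apply/eqP/val_inj => /=.
      by rewrite -[gval R1](conjsgK a) defR1 fixR ?groupV.
    by have := actsP actsM a (subsetP sCM a ca) R1; rewrite /= !inE in sylR1 * => ->.
  have := dvdn_orbit 'JG <[c]> R1; rewrite -orderE oc.
  rewrite (dvdn_divisors _ (isT : 0 < 5)) !inE => /orP[/eqP o1|/eqP-> //].
  case/eqP: neR1; apply/val_inj/nR_R1 => //; apply/normP.
  have /orbit1P/afixP/(_ c (cycle_id c)) := card_orbit1 o1.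
  by move/(congr1 val).
have Xy1: (R1 :^ y)%G \in 'Syl_5(M) :\ R.
  rewrite !inE in sylR1 *; rewrite -{1}(normP (subsetP nMX y Xy)) pHallJ2 sylR1 andbT.
  apply: contraNneq neR1 => /(congr1 val) /= defR1; apply/eqP/val_inj => /=.
  by rewrite -[gval R1](conjsgK y) defR1 -{1}nRy conjsgK.
rewrite -orbR1 in Xy1; have /orbitP[a ca /(congr1 val) /= defR1y] := Xy1.
have cac: commute a c by apply/cent1P; rewrite -cent_cycle; apply: subsetP ca; apply: cycle_abelian.
have Ma := subsetP sCM a ca.
suffices /eqP: y * a^-1 = 1 by rewrite -eq_mulgV1 => /eqP->.
apply: faithful => [|R2 sylR2]; first by rewrite groupM // groupV (subsetP sMX).
have [->|neR2] := eqVneq R2 R.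
  rewrite groupMr ?groupV; first exact/normP.
  by apply/normP/fixR.
have: R2 \in orbit 'JG <[c]> R1 by rewrite orbR1 !inE neR2; move: sylR2; rewrite inE.
case/orbitP=> b cb <-; apply/normP => /=.
have cwb: commute b (y * a^-1).
  have cwc: commute c (y * a^-1).
    by apply: commuteM; [apply: commute_sym | apply/commuteV/commute_sym].
  have /cycleP[i ->] := cb; exact/commute_sym/commuteX/commute_sym.
by rewrite -conjsgM cwb !conjsgM -defR1y conjsgK.
Qed.

End Rigidity.

Lemma k2'_max_solvable_group (gT : finGroupType) (G : {group gT}) :
  k2' G = h G -> solvable G.
Proof.
move=> maxG; apply: contraT => /nonsolvable_d2'_le; rewrite maxG leqNgt => /negP[].
by rewrite ltn_pmul2r // part_gt0.
Qed.

(** Let [S] be a maximal normal subgroup of [M]. Minimality makes [M] perfect, so [M / S] is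
    nonabelian and tightness makes [S] solvable. Its Fitting subgroup lies in that of [M], which is
    trivial, so [S] is trivial. *)
Lemma tight_minnormal_simple (gT : finGroupType) (X M : {group gT}) :
    (forall L : {group gT}, L <| X -> solvable L -> L :=: 1) ->
    minnormal M X -> M <| X -> ~~ solvable M -> (15 * k2' M = 4 * h M)%N ->
  simple M.
Proof.
move=> radX /mingroupP[/andP[ntM nMX] minM] nsMX nsolM tightM.
have [S maxS] := ex_maxnormal_ntrivg ntM; have nsSM := maxnormal_normal maxS.
have simQ: simple (M / S) by rewrite quotient_simple.
have nabQ: ~~ abelian (M / S).
  apply/negP=> abQ; have sM'S := der1_min (normal_norm nsSM) abQ.
  have ntM': M^`(1) != 1.
    by apply: contra nsolM => /eqP/derG1P/abelian_sol.
  have defM: M^`(1) = M.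
    apply: minM (der_sub 1 M); rewrite ntM' /=.
    exact: normal_norm (char_normal_trans (der_char 1 M) nsMX).
  by have /andP[_ /negP[]] := maxnormal_proper maxS; rewrite -defM.
have nsolQ := simple_nonsolvable simQ nabQ.
have solS: solvable S.
  have [_ maxS' _] := tight_quotient_nonsolvable nsSM tightM nsolQ.
  exact: k2'_max_solvable_group.
have F1: 'F(M) = 1.
  apply: radX; last exact: nilpotent_sol (Fitting_nil M).
  exact: char_normal_trans (Fitting_char M) nsMX.
have: 'F(S) == 1.
  rewrite -subG1 -F1; apply: Fitting_max (Fitting_nil S).
  exact: char_normal_trans (Fitting_char S) nsSM.
rewrite (trivg_Fitting solS) => /eqP S1.
by rewrite (isog_simple (quotient1_isog M)) -S1.
Qed.

(** A minimal normal subgroup [M] is [A_5]. Its centraliser embeds in [X / M], which is solvable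
    because there the number of classes equals the odd part; hence the centraliser is trivial and
    rigidity applies. *)
Lemma tight_radical_free (gT : finGroupType) (X : {group gT}) :
    (forall L : {group gT}, L <| X -> solvable L -> L :=: 1) ->
    ~~ solvable X -> (15 * k2' X = 4 * h X)%N ->
  X \isog 'Alt_('I_5).
Proof.
move=> radX nsolX tightX.
have ntX: X :!=: 1 by apply: contraNneq nsolX => ->; apply: solvable1.
have [M minM sMX] := minnormal_exists ntX (normG X).
have /mingroupP[/andP[ntM nMX] _] := minM.
have nsMX: M <| X by apply/andP.
have nsolM: ~~ solvable M by apply: contra ntM => /(radX _ nsMX)/eqP.
have [tightM maxQ eqX] := tight_normal_nonsolvable nsMX tightX nsolM.
have simM := tight_minnormal_simple radX minM nsMX nsolM tightM.
have nabM: ~~ abelian M by apply: contra nsolM => /abelian_sol.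
have [_ /(_ tightM) isoM] := simple_d2'_le simM nabM.
have nMC: 'C_X(M) \subset 'N(M) by apply: subset_trans (subsetIl _ _) nMX.
have cMX: 'C_X(M) = 1.
  apply: (radX 'C_X(M)%G).
    by rewrite /normal subsetIl normsI ?normG ?norms_cent.
  have TI: M :&: 'C_X(M) = 1.
    have [_ min1] := simpleP _ simM.
    have nsZM: 'C_M(M) <| M by rewrite /normal subsetIl normsI ?normG ?norms_cent.
    have [ZM1 | ZM] := min1 _ nsZM.
      by apply/trivgP; rewrite -ZM1 /= setIS // subsetIr.
    by case/negP: nabM; rewrite /abelian -{1}ZM subsetIr.
  rewrite /= (isog_sol (quotient_isog nMC TI)).
  apply: solvableS (k2'_max_solvable_group maxQ).
  by rewrite quotientS ?subsetIl.
have fus: {in M, forall x, odd #[x] -> x ^: X = x ^: M}.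
  by move=> x Mx odd_x; rewrite (k2'_quo_eq nsMX eqX Mx odd_x).
by rewrite (Alt5_rigid nsMX isoM cMX fus).
Qed.

Lemma Alt5_central_extension (gT : finGroupType) (G N : {group gT}) :
    N \subset 'Z(G) -> odd #|N| -> G / N \isog 'Alt_('I_5) ->
  G \isog setX 'Alt_('I_5) 'Z(G).
Proof.
move=> sNZ odd_N isoQ; have [simQ nabQ oQ] := isog_Alt5 isoQ.
have sNG: N \subset G := subset_trans sNZ (center_sub G).
have cNG: G \subset 'C(N).
  by rewrite centsC (subset_trans sNZ) ?subsetIr.
have nNG: G \subset 'N(N) := subset_trans cNG (cent_sub N).
have nsNG: N <| G by apply/andP.
have defZ: 'Z(G) = N.
  apply/eqP; rewrite eqEsubset sNZ andbT -quotient_sub1 ?(subset_trans (center_sub G)) //.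
  have [_ min1] := simpleP _ simQ.
  have [<- | ZQ] := min1 _ (center_normal (G / N)).
    rewrite subsetI quotientS ?center_sub //= quotient_cents2r //.
    by rewrite (commG1P _) ?sub1G // subsetIr.
  by case/negP: nabQ; rewrite /abelian -{1}ZQ subsetIr.
have TI: N :&: G^`(1) = 1.
  apply/eqP/negPn/negP=> ntNG'.
  have [|p pr_p p_dvd] := pdivP (n := #|N :&: G^`(1)|).
    by rewrite cardG_gt1.
  have [z /setIP[Nz G'z] oz] := Cauchy pr_p p_dvd.
  have odd_p: odd p by apply: dvdn_odd odd_N; rewrite (dvdn_trans p_dvd) ?cardSg ?subsetIl.
  have [T sylT] := Sylow_exists p G; have sTG := pHall_sub sylT.
  have cTN: N \subset 'C(T) by rewrite centsC (subset_trans sTG).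
  have Tz: z \in T.
    have pz: p.-group <[z]> by rewrite /pgroup -orderE oz pnat_id.
    have sZG: <[z]> \subset G by rewrite cycle_subG (subsetP sNG).
    have [g Gg] := Sylow_subJ sylT sZG pz; rewrite cycle_subG mem_conjg.
    by rewrite (conjg_fixP _) //; apply/commgP/commute_sym/(centsP cNG); rewrite ?groupV.
  (* [T / 'Z(T)] has order dividing 60, because [T :&: N] is central. It is a p-group with [p] odd,
     so its order is 1, 3 or 5 and it is cyclic. *)
  have abT: abelian T.
    apply: cyclic_center_factor_abelian.
    have sTNZ: T :&: N \subset 'Z(T) by rewrite setIS.
    have p_d: p.-nat #|T / 'Z(T)| by apply: quotient_pgroup (pHall_pgroup sylT).
    have d60: #|T / 'Z(T)| %| 15 * 4.
      have nNT := subset_trans sTG nNG.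
      apply: dvdn_trans (_ : #|T / N| %| _); last first.
        by have:= cardSg (quotientS N sTG); rewrite oQ.
      rewrite (card_quotient nNT) card_quotient ?normal_norm ?center_normal //.
      by rewrite -(indexgI T N) -(Lagrange_index (center_sub T) sTNZ) dvdn_mulr.
    have d15: #|T / 'Z(T)| %| 15.
      rewrite -(@Gauss_dvdl _ _ 4) // (pnat_coprime p_d) // p'natE //.
      rewrite -[4]/(2 ^ 2)%N Euclid_dvdX // dvdn_prime2 // andbT.
      by apply: contraL odd_p => /eqP->.
    have: #|T / 'Z(T)| \in divisors 15 by rewrite -dvdn_divisors.
    rewrite -[divisors 15]/[:: 1; 3; 5; 15]%N !inE => /or4P[]/eqP od.
    - by rewrite (card1_trivg od) cyclic1.
    - by rewrite prime_cyclic ?od.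
    - by rewrite prime_cyclic ?od.
    rewrite od in p_d; have p3: 3 == p by apply: (pnatPpi p_d).
    have p5: 5 == p by apply: (pnatPpi p_d).
    by rewrite -(eqP p3) in p5.
  suffices z1: z = 1 by move: oz pr_p; rewrite z1 order1 => <-.
  apply: (transfer_fixed sTG abT) G'z => //.
    exact: pnat_coprime (pHall_pgroup sylT) (andP (andP sylT).2).2.
  move=> n x Gx _; apply/conjg_fixP/commgP/commute_sym/(centsP cNG) => //.
  exact: groupX.
have defG: N * G^`(1) = G.
  apply/eqP; rewrite eqEsubset mul_subG ?der_sub //= -quotientSK //.
  by rewrite quotient_der // (simple_perfect simQ nabQ).
have dG: G^`(1) \x N = G.
  by rewrite dprodC dprodE // (subset_trans (der_sub 1 G)).
apply: isog_dprod dG (setX_dprod _ _) _ _.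
  apply: isog_trans (isog_setX1 _ _); apply: isog_trans isoQ.
  have := quotient_isog (subset_trans (der_sub 1 G) nNG) TI.
  by rewrite quotient_der // (simple_perfect simQ nabQ).
by rewrite /= defZ; apply: isog_set1X.
Qed.

(** Tightness makes the solvable radical [N] abelian of odd order and keeps its classes from growing
    in [G], so [N] is central; [G / N] has trivial radical and is again tight. *)
Lemma tight_structure (gT : finGroupType) (G : {group gT}) :
    ~~ solvable G -> 'O_2(G) = 1 -> (15 * k2' G = 4 * h G)%N ->
  G \isog setX 'Alt_('I_5) 'Z(G).
Proof.
move=> nsolG O2G tightG.
have [N maxN] : {N : {group gT} | [max N | (N <| G) && solvable N]}.
  by apply: ex_maxgroup; exists 1%G; rewrite normal1 solvable1.
have /maxgroupP[/andP[nsNG solN] maxN'] := maxN.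
have nsolQ: ~~ solvable (G / N) by apply: contra nsolG => solQ; rewrite (series_sol nsNG) solN.
have [tightQ maxkN eqG] := tight_quotient_nonsolvable nsNG tightG nsolQ.
have O2N: 'O_2(N) = 1.
  apply/trivgP; rewrite -O2G pcore_max ?pcore_pgroup //.
  exact: char_normal_trans (pcore_char 2 N) nsNG.
have /andP[abN odd_N] := k2'_max_solvable solN O2N maxkN.
apply: (@Alt5_central_extension _ _ N) => //.
  rewrite subsetI normal_sub //; apply/centsP=> x Nx y Gy.
  have odd_x: odd #[x] by apply: dvdn_odd (order_dvdG Nx) odd_N.
  apply/commgP/conjg_fixP; have: x ^ y \in x ^: G by rewrite imset_f.
  rewrite (k2'_quo_eq nsNG eqG Nx odd_x) => /imsetP[z Nz ->].
  by apply/conjg_fixP/commgP/(centsP abN).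
apply: tight_radical_free => // L nsLQ solL.
have [K defL sNK nsKG] := inv_quotientN nsNG nsLQ.
have nsNK: N <| K by apply: normalS sNK (normal_sub nsKG) nsNG.
have KN: K :=: N.
  by apply: maxN' => //; rewrite nsKG (series_sol nsNK) solN -defL.
by rewrite defL KN trivg_quotient.
Qed.

Lemma k2'_setX (gT rT : finGroupType) (A : {group gT}) (B : {group rT}) :
  k2' A * k2' B <= k2' (setX A B).
Proof.
have gt0: 0 < #|A| * #|B| by rewrite muln_gt0 !cardG_gt0.
rewrite -(leq_pmul2r gt0) mulnACA -cardsX.
rewrite (k2'_sum_cent [group of setX A B]) !k2'_sum_cent /= big_distrlr /=.
rewrite pair_big_dep /=.
rewrite [leqRHS]big_mkcond [leqLHS]big_mkcond /=; apply: leq_sum => -[a b] _ /=.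
case: ifP => // /andP[/andP[Aa odd_a] /andP[Bb odd_b]].
have odd_ab: odd #[(a, b)].
  apply: dvdn_odd (_ : #[(a, b)] %| #[a] * #[b]) _; last by rewrite oddM odd_a.
  have powE n: (a, b) ^+ n = (a ^+ n, b ^+ n) by elim: n => // n IHn; rewrite !expgS IHn.
  by rewrite order_dvdn powE expgM expg_order expg1n mulnC expgM expg_order expg1n.
rewrite in_setX Aa Bb odd_ab /= -cardsX; apply/subset_leq_card/subsetP=> -[x y].
rewrite in_setX => /andP[/setIP[Ax /cent1P cax] /setIP[By /cent1P cby]].
rewrite inE in_setX Ax By; apply/cent1P; rewrite /commute.
by congr (_, _).
Qed.

Lemma k2'_abelian_odd (gT : finGroupType) (Z : {group gT}) :
  abelian Z -> odd #|Z| -> k2' Z = #|Z|.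
Proof.
move=> abZ odd_Z; apply/eqP; rewrite -(eqn_pmul2r (cardG_gt0 Z)) k2'_sum_cent.
rewrite (eq_bigl (fun x => x \in Z)) => [|x]; last first.
  by rewrite andb_idr // => Zx; apply: dvdn_odd (order_dvdG Zx) odd_Z.
rewrite (eq_bigr (fun=> #|Z|)) ?sum_nat_const // => x Zx.
by rewrite (setIidPl _) // sub_cent1 (subsetP abZ).
Qed.

(** The classes are those of 1, of an [s] of order 3, and of [c] and [c ^+ 2] with [c] of order 5.
    An element conjugating [c] to its square would have order divisible by 4, making the Sylow
    2-subgroups of order 4 cyclic. *)
Lemma k2'_Alt5 (gT : finGroupType) (M : {group gT}) :
  M \isog 'Alt_('I_5) -> 4 <= k2' M.
Proof.
move=> isoM; have [simM nabM oM] := isog_Alt5 isoM.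
have [|s Ms os] := @Cauchy _ 3 M isT; first by rewrite oM.
have [|c Mc oc] := @Cauchy _ 5 M isT; first by rewrite oM.
have oc2: #[c ^+ 2] = 5 by rewrite orderXgcd oc.
have ncc2: c ^+ 2 \notin c ^: M.
  apply/imsetP=> [[g Mg cg]].
  have cgn n: c ^ (g ^+ n) = c ^+ (2 ^ n).
    elim: n => [|n IHn]; first by rewrite conjg1.
    by rewrite expgSr conjgM IHn conjXg -cg -expgM expnS.
  have dv4: 4 %| #[g].
    have: c ^+ (2 ^ #[g]) == c ^+ 1 by rewrite -cgn expg_order conjg1.
    rewrite eq_expg_mod_order oc {1}(divn_eq #[g] 4) expnD mulnC [(_ * 4)%N]mulnC expnM.
    rewrite -modnMmr -modnXm -[(2 ^ 4 %% 5)%N]/1%N exp1n muln1 /dvdn.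
    by have := ltn_pmod #[g] (isT : 0 < 4); case: (#[g] %% 4) => [|[|[|[|]]]].
  have [P sylP] := Sylow_exists 2 M.
  have oP: #|P| = 4.
    by rewrite (card_Hall sylP) oM -[60]/(4 * 15)%N partnM // part_pnat_id // part_p'nat.
  have p_u: 2.-group <[g.`_2]> by apply: p_elt_constt.
  have sUM: <[g.`_2]> \subset M by rewrite cycle_subG groupX.
  have oU: 4 <= #|<[g.`_2]>|.
    rewrite -orderE order_constt dvdn_leq ?part_gt0 //.
    by rewrite -(@part_pnat_id 2 4) // partn_dvd // order_gt0.
  have [x Mx sUPx] := Sylow_subJ sylP sUM p_u.
  have defPx: <[g.`_2]> = P :^ x by apply/eqP; rewrite eqEcard sUPx cardJg oP.
  have ntP: P :!=: 1 by rewrite trivg_card1 oP.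
  case/negP: (simple_Sylow2_noncyclic simM nabM sylP ntP).
  by rewrite -(cyclicJ _ x) -defPx cycle_cyclic.
rewrite /k2'; set K := [set _ | _ in _ & _].
pose e := [seq x ^: M | x <- [:: 1; s; c; c ^+ 2]].
have ordE x y : x \in M -> y ^: M = x ^: M -> #[y] = #[x].
  by move=> Mx eqC; have /imsetP[z _ ->]: y \in x ^: M; rewrite -?eqC ?class_refl ?orderJ.
have uniq_e: uniq e.
  rewrite /= !inE !andbT !negb_or -!andbA; apply/and5P; split.
  - by apply/eqP=> /ordE; rewrite order1 os => /(_ Ms).
  - by apply/eqP=> /ordE; rewrite order1 oc => /(_ Mc).
  - by apply/eqP=> /ordE; rewrite order1 oc2 groupX // => /(_ isT).
  - by apply/eqP=> /ordE; rewrite os oc => /(_ Mc).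
  apply/andP; split; first by apply/eqP=> /ordE; rewrite os oc2 groupX // => /(_ isT).
  by apply: contra ncc2 => /eqP->; rewrite class_refl.
have sub_e: {subset e <= enum K}.
  move=> C /mapP[x]; rewrite !inE => ex ->; rewrite mem_enum; apply/imsetP; exists x => //.
  by rewrite inE; case/or4P: ex => /eqP->; rewrite ?group1 ?groupX ?Ms ?Mc ?order1 ?os ?oc ?oc2.
by rewrite cardE; apply: leq_trans (uniq_leq_size uniq_e sub_e).
Qed.

Lemma Alt5_setX_tight (gT : finGroupType) (G : {group gT}) :
    ~~ solvable G -> 'O_2(G) = 1 -> G \isog setX 'Alt_('I_5) 'Z(G) ->
  (15 * k2' G = 4 * h G)%N.
Proof.
move=> nsolG O2G isoG; apply/eqP; rewrite eqn_leq nonsolvable_d2'_le //=.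
have odd_Z: odd #|'Z(G)|.
  rewrite odd_2'nat; have := nilpotent_pcore_Hall 2 (abelian_nil (center_abelian G)).
  have ->: 'O_2('Z(G)) = 1.
    apply/trivgP; rewrite -O2G pcore_max ?pcore_pgroup //.
    exact: char_normal_trans (pcore_char 2 _) (center_normal G).
  by move/card_Hall; rewrite cards1 => /esym/eqP; rewrite partn_eq1.
have oG: h G = (15 * #|'Z(G)|)%N.
  rewrite (card_isog isoG) cardsX card_Alt5 partnM ?cardG_gt0 //.
  by rewrite (@part_pnat_id _ #|'Z(G)|) -?odd_2'nat // -[60]/(4 * 15)%N partnM // part_p'nat // part_pnat_id.
rewrite oG mulnCA leq_pmul2l // (isog_k2' isoG).
apply: leq_trans (k2'_setX _ _).
by rewrite leq_mul ?k2'_Alt5 ?isog_refl // k2'_abelian_odd ?center_abelian.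
Qed.

(** * Bounding the 2-length *)

Section Lift.
Variables (gT : finGroupType) (G N : {group gT}).
Hypothesis nsNG : N <| G.
Let pre (A : {group coset_of N}) := (coset N @*^-1 A)%G.

Let pre_quo pi (A B : {group coset_of N}) : A <| G / N -> B <| G / N -> A \subset B ->
  pi.-group (pre B / pre A) = pi.-group (B / A).
Proof.
move=> nsA nsB sAB; have nsAB: A <| B by apply: normalS sAB (normal_sub nsB) nsA.
have nsAB': pre A <| pre B by rewrite cosetpre_normal.
congr (_.-nat _); rewrite !card_quotient ?normal_norm // -!divgS ?normal_sub //=.
by rewrite !card_cosetpre divnMl.
Qed.

Let lift_series (A : {group coset_of N}) s :
    A <| G / N -> all (fun B : {group coset_of N} => B <| G / N) s ->
    path (@two_series_step _) A s ->
  path (@two_series_step _) (pre A) (map pre s) /\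
  count (fun AB : {group gT} * {group gT} => ~~ (2^')%N.-group (AB.2 / AB.1))
        (zip (map pre (A :: s)) (map pre s))
  = count (fun AB : {group coset_of N} * {group coset_of N} => ~~ (2^')%N.-group (AB.2 / AB.1))
        (zip (A :: s) s).
Proof.
elim: s A => [|B s IHs] A //= nsA /andP[nsB nss] /andP[/andP[sAB pAB] path_s].
have [path' count'] := IHs B nsB nss path_s.
split; last by rewrite [in LHS]pre_quo // -count'.
by rewrite path' andbT /two_series_step !pre_quo // cosetpreSK sAB.
Qed.

(** The series of the quotient is pulled back, keeping the orders of its factors, and [N] is put in
    front; it counts as a further 2-factor only if its order is even. *)
Lemma two_length_quo n : 2.-group N || odd #|N| ->
  two_length_le (G / N) n -> two_length_le G (n + ~~ odd #|N|).
Proof.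
move=> pN [s [/and3P[path_s /eqP last_s nss] count_s]].
have [path' count'] := lift_series (normal1 _) nss path_s.
have pre1: pre 1%G = N by apply/val_inj; rewrite /= -kerE ker_coset.
have N1 pi : pi.-group (N / 1%G) = pi.-group N.
  by rewrite /pgroup card_quotient ?norms1 // indexg1.
have lastE := last_map pre s 1%G; rewrite pre1 in path' lastE.
rewrite /= pre1 in count'.
exists (N :: map pre s); split.
  apply/and3P; split=> //=.
  - by rewrite path' andbT /two_series_step sub1G !N1 [2^'.-group N]/pgroup -odd_2'nat.
  - by rewrite lastE /= last_s quotientGK.
  rewrite nsNG /=; apply/allP=> _ /mapP[B sB ->].
  have nsB := allP nss B sB.
  by rewrite -(quotientGK nsNG) /pre /= cosetpre_normal.
rewrite /two_factors /= N1 /pgroup -odd_2'nat.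
by rewrite count' addnC leq_add.
Qed.

End Lift.

Lemma two_length_odd (gT : finGroupType) (G : {group gT}) n :
  odd #|G| -> two_length_le G n.
Proof.
move=> oddG; exists [:: G].
have pG: (2^')%N.-group (G / 1%G).
  by rewrite /pgroup card_quotient ?norms1 // indexg1 -odd_2'nat.
by rewrite /two_series /two_factors /= /two_series_step sub1G pG orbT eqxx normal_refl.
Qed.

Lemma two_length_leW (gT : finGroupType) (G : {group gT}) m n :
  m <= n -> two_length_le G m -> two_length_le G n.
Proof. by move=> le_mn [s [ser_s le_s]]; exists s; split=> //; apply: leq_trans le_mn. Qed.

Lemma odd_part_quo_2group (gT : finGroupType) (G N : {group gT}) :
  N <| G -> 2.-group N -> h (G / N) = h G.
Proof.
move=> nsNG pN; rewrite (odd_part_quo nsNG).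
by rewrite [X in _ = (X * _)%N]part_p'nat ?mul1n // pnatNK.
Qed.

(** As ['O_2(B)] is trivial, some 2-element [t] does not centralise [Y]. Its centraliser [C] in [Y]
    has odd index, at least 3, and [t] fuses elements outside [C] at least in pairs, so the number
    of classes is at most [(#|Y| + #|C|) / 2]. *)
Lemma k2'_odd_by_2group (gT : finGroupType) (B Y : {group gT}) :
    Y <| B -> odd #|Y| -> 2.-group (B / Y) -> 'O_2(B) = 1 -> ~~ odd #|B| ->
  3 * k2' B <= 2 * h B.
Proof.
move=> nsYB oddY pBY O2B evenB; have [sYB nYB] := andP nsYB.
have hallY: (2^')%N.-Hall(B) Y.
  rewrite /pHall sYB -[(2^').-group Y]odd_2'nat oddY /= pnatNK.
  by rewrite -card_quotient.
have [T sylT] := Sylow_exists 2 B; have [sTB pT _] := and3P sylT.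
have [t Tt nYt]: exists2 t, t \in T & t \notin 'C(Y).
  apply/subsetPn; apply: contra evenB => cYT.
  have defB: Y * T = B.
    apply/eqP; rewrite eqEcard mul_subG //= coprime_cardMg ?(card_Hall hallY) ?(card_Hall sylT).
      by rewrite mulnC partnC.
    by rewrite coprime_sym coprime_partC.
  have nsTB: T <| B.
    by rewrite /normal sTB -defB mul_subG ?normG // cents_norm // centsC.
  have T1: T :=: 1 by apply/trivgP; rewrite -O2B pcore_max.
  by rewrite -defB T1 mulg1.
have nYt': t \in 'N(Y) by apply: (subsetP nYB); apply: (subsetP sTB).
have Bt := subsetP sTB t Tt.
pose C := 'C_Y[t].
have ltCY: 3 * #|C| <= #|Y|.
  have sCY: C \subset Y := subsetIl _ _.
  rewrite -(Lagrange sCY) mulnC leq_pmul2l ?cardG_gt0 //.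
  have: odd #|Y : C| by apply: dvdn_odd (dvdn_indexg _ _) oddY.
  have: #|Y : C| != 1%N.
    apply: contra nYt; rewrite indexg_eq1 => sYC; apply/centP=> y Yy.
    by have /setIP[_ /cent1P] := subsetP sYC y Yy.
  by case: #|_ : _| => [|[|[|]]].
have hB: h B = #|Y| by rewrite (card_Hall hallY).
pose f x := x ^: B.
have le_k: k2' B <= #|C| + #|f @: (Y :\: C)|.
  apply: leq_trans (leq_add (leq_imset_card f _) (leqnn _)).
  apply: leq_trans (leq_card_setU _ _); rewrite -imsetU.
  apply/subset_leq_card/imsetS/subsetP=> x /setIdP[Bx odd_x].
  have Yx: x \in Y by rewrite (mem_normal_Hall hallY nsYB Bx) /p_elt -odd_2'nat.
  by rewrite !inE Yx /= andbT orbN.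
have le2: 2 * #|f @: (Y :\: C)| <= #|Y :\: C|.
  apply: (card_imset_pair (s := fun x => x ^ t)) => x /setDP[Yx].
  rewrite in_setI Yx => /= ncx.
  have ncx': x ^ t != x by apply: contra ncx => /eqP/conjg_fixP/commgP cxt; apply/cent1P.
  rewrite in_setD in_setI !memJ_norm // ?Yx ?ncx' /f ?classGidl //=; first by rewrite ncx.
  by rewrite (subsetP (normG _)) ?cent1id.
have := cardsID C Y; rewrite (setIidPr (subsetIl Y 'C[t] : C \subset Y)) => cardD.
move: le_k le2 cardD ltCY; rewrite hB; clear; lia.
Qed.

(** Each passage from [G] to [G / B], with [B / Y] the group ['O_2(G / Y)], costs a factor 2/3 and
    one 2-factor. The case [n = 0] is vacuous, since the ratio never exceeds 1, and this accounts
    for [n.-1]. *)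
Lemma two_length_bound n (gT : finGroupType) (G : {group gT}) :
    solvable G -> 'O_2(G) = 1 -> 2 ^ n * h G < 3 ^ n * k2' G ->
  two_length_le G n.-1.
Proof.
elim: n gT G => [|n IHn] gT G solG O2G ltG.
  by move: ltG; rewrite !mul1n ltnNge k2'_le_odd_part.
have [oddG | evenG] := boolP (odd #|G|); first exact: two_length_odd.
pose Y := 'O_2^'(G)%G; have nsYG: Y <| G := pcore_normal _ _.
have oddY: odd #|Y| by rewrite odd_2'nat; apply: pcore_pgroup.
have O2'1: 'O_2^'(G / Y) = 1 by apply: trivg_pcore_quotient.
have [B defB sYB nsBG] := inv_quotientN nsYG (pcore_normal 2 (G / Y)).
have nsYB: Y <| B by apply: normalS nsYG => //; apply: normal_sub.
have pBY: 2.-group (B / Y) by rewrite -defB pcore_pgroup.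
(* Otherwise the Fitting subgroup of the solvable [G / Y] would have trivial 2-part and trivial odd
   part, forcing [G = Y]. *)
have ntBY: B / Y != 1.
  rewrite -defB; apply: contraNneq evenG => O2GY.
  have /eqP: G / Y = 1.
    apply/eqP/idPn=> ntGY; have solGY := quotient_sol Y solG.
    have /negP[] := ntGY; rewrite -trivg_Fitting //.
    have O1 pi: 'O_pi(G / Y) = 1 -> 'O_pi('F(G / Y)) = 1.
      move=> O1; apply/trivgP; rewrite -O1 pcore_max ?pcore_pgroup //.
      exact: char_normal_trans (pcore_char _ _) (Fitting_normal _).
    by rewrite -(dprodW (nilpotent_pcoreC 2 (Fitting_nil _))) !O1 ?mulg1.
  rewrite -subG1 quotient_sub1 ?normal_norm // => sGY.
  exact: oddSg sGY oddY.
have evenB: ~~ odd #|B|.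
  apply: contra ntBY => oddB; rewrite trivg_card1.
  rewrite -(pnat_1 pBY) //= -odd_2'nat; exact: dvdn_odd (dvdn_quotient _ _) oddB.
have O2B: 'O_2(B) = 1.
  apply/trivgP; rewrite -O2G pcore_max ?pcore_pgroup //.
  exact: char_normal_trans (pcore_char _ _) nsBG.
have le_B := k2'_odd_by_2group nsYB oddY pBY O2B evenB.
have nsBG1: (B / Y)%G <| G / Y by apply: quotient_normal.
have isoGB: (G / Y) / (B / Y) \isog G / B by apply: third_isog.
have le_G := k2'_quo_le nsBG; have hG := odd_part_quo nsBG.
have hGB: h ((G / Y) / (B / Y)) = h (G / B) by rewrite (card_isog isoGB).
have lt_n: 2 ^ n * h (G / B) < 3 ^ n * k2' (G / B).
  rewrite -(ltn_pmul2l (_ : 0 < 2 * h B)) ?muln_gt0 ?part_gt0 //.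
  rewrite mulnACA -expnS -hG; apply: leq_trans ltG _; rewrite expnS.
  rewrite -mulnA mulnCA [leqRHS]mulnCA leq_mul2l.
  rewrite (leq_trans (leq_mul (leqnn 3) le_G)) ?orbT // mulnA leq_mul2r le_B orbT //.
have n_gt0: 0 < n.
  by case: n lt_n {IHn ltG} => //; rewrite !mul1n ltnNge k2'_le_odd_part.
have := @two_length_quo _ _ _ nsBG1 n.-1; rewrite pBY => /(_ isT).
have -> : ~~ odd #|(B / Y)%G| = true.
  apply: contra ntBY => oddBY; rewrite trivg_card1.
  by rewrite -(pnat_1 pBY) //= -odd_2'nat.
rewrite addn1 prednK // => len_quo.
have := @two_length_quo _ _ _ nsYG n; rewrite oddY orbT addn0 => /(_ isT); apply.
apply: len_quo; apply: IHn; rewrite ?quotient_sol //.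
  by rewrite /= -defB trivg_pcore_quotient.
by rewrite hGB (isog_k2' isoGB).
Qed.

Lemma two_length_le4 (gT : finGroupType) (G : {group gT}) :
  solvable G -> 4 * h G < 15 * k2' G -> two_length_le G 4.
Proof.
move=> solG ltG; have nsN := pcore_normal 2 G; have pN := pcore_pgroup 2 G.
have: two_length_le (G / 'O_2(G)) 3.
  (* 4 is the least exponent that works: 16/81 < 4/15 < 8/27. The fourth 2-factor is ['O_2(G)]
     itself. *)
  apply: (@two_length_bound 4); rewrite ?quotient_sol //.
    exact: trivg_pcore_quotient.
  rewrite k2'_quo_2group // odd_part_quo_2group //.
  by move: ltG; generalize (h G) (k2' G); lia.
move/(two_length_quo nsN); rewrite pN => /(_ isT).
by apply: two_length_leW; case: odd.
Qed.

Section Ratio.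
Import Order.TTheory GRing.Theory Num.Theory.

Lemma d2'_gt (gT : finGroupType) (G : {group gT}) (a b : nat) : 0 < b ->
  ((a%:R / b%:R : rat) < d2' G)%R = (a * h G < b * k2' G).
Proof.
move=> b_gt0; rewrite /d2' ltr_pdivrMr ?ltr0n // mulrAC ltr_pdivlMr ?ltr0n ?part_gt0 //.
by rewrite -!natrM ltr_nat [in RHS]mulnC [(b * _)%N]mulnC mulnC.
Qed.

Lemma d2'_eq (gT : finGroupType) (G : {group gT}) (a b : nat) : 0 < b ->
  (d2' G == (a%:R / b%:R : rat)%R) = (b * k2' G == a * h G)%N.
Proof.
move=> b_gt0; rewrite /d2' eqr_div ?pnatr_eq0 -?lt0n ?part_gt0 //.
by rewrite -!natrM eqr_nat mulnC.
Qed.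

End Ratio.

Theorem theorem1p2 (gT : finGroupType) (G : {group gT}) :
  (((4%:R / 15%:R : rat) < d2' G)%R -> solvable G /\ two_length_le G 4)
  /\
  (~~ solvable G ->
     (d2' G = (4%:R / 15%:R : rat)%R <->
      (G / 'O_2(G)) \isog setX ('Alt_('I_5)) 'Z(G / 'O_2(G)))).
Proof.
have nsN := pcore_normal 2 G; have pN := pcore_pgroup 2 G.
split=> [|nsolG].
  rewrite d2'_gt // => ltG; have solG: solvable G.
    by apply: contraLR ltG => nsolG; rewrite -leqNgt nonsolvable_d2'_le.
  by split=> //; apply: two_length_le4.
have nsolH: ~~ solvable (G / 'O_2(G)).
  by apply: contra nsolG => solH; rewrite (series_sol nsN) (pgroup_sol pN).
have O2H: 'O_2(G / 'O_2(G)) = 1 by apply: trivg_pcore_quotient.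
have kH := k2'_quo_2group nsN pN; have hH := odd_part_quo_2group nsN pN.
transitivity (15 * k2' G = 4 * h G)%N; first by split=> /eqP; rewrite ?d2'_eq // => /eqP; [|move=> E; apply/eqP; rewrite d2'_eq //; apply/eqP].
rewrite -kH -hH; split=> [tight | isoH]; first exact: tight_structure.
exact: Alt5_setX_tight.
Qed.
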